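(* Suppose the EEC computation type $\underline R$ is either (i) a computation-type constant, or (ii) the type $\underline I$. Then: (1) If $\Theta\vdash M:\tau$, $\Theta\vdash N:\tau$ and $\Theta^{lv}\mid-\vdash M^{lv}=N^{lv}:(\tau^{lv}\Rightarrow\underline R)\multimap\underline R$ in EEC, then $\Theta\vdash M=_{\lambda_c}N:\tau$. (2) If $\Theta^{lv}\mid-\vdash t:(\tau^{lv}\Rightarrow\underline R)\multimap\underline R$ is an EEC term, then there exists a simply-typed term $\Theta\vdash M:\tau$ such that $\Theta^{lv}\mid-\vdash M^{lv}=t:(\tau^{lv}\Rightarrow\underline R)\multimap\underline R$.
   Context: **EEC (enriched effect calculus).** There are value-type constants $\alpha,\beta,\ldots$ and a disjoint set of computation-type constants $\underline{\alpha},\underline{\beta},\ldots$. Value types $A,B,C$ and computation types $\underline{A},\underline{B},\underline{C},\underline{D}$ are generated by $A::=\alpha\mid 1\mid A\times B\mid A\to B\mid \underline{A}\mid \underline{A}\multimap\underline{B}$ and $\underline{A}::=\underline{\alpha}\mid\underline{1}\mid\underline{A}\,\&\,\underline{B}\mid A\Rightarrow\underline{B}\mid\underline{I}\mid\ !A\mid\ !A\otimes\underline{B}\mid\underline{0}\mid\underline{A}\oplus\underline{B}$ (every computation type is also a value type; $!A\otimes\underline{B}$ is one primitive binary constructor). Judgements are $\Gamma\mid -\vdash t:A$ and $\Gamma\mid z{:}\underline{A}\vdash t:\underline{B}$, where $\Gamma$ lists distinct variables with value types and the ''stoup'' holds at most one variable, of computation type; with nonempty stoup the result type is a computation type. Below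 $\Delta$ is empty or $z{:}\underline{D}$. Typing rules: $\Gamma,x{:}A\mid-\vdash x:A$; $\Gamma\mid-\vdash *:1$; pairs $\langle t,u\rangle:A\times B$, projections $\pi_1t,\pi_2t$; $\lambda x{:}A.t:A\to B$ from $\Gamma,x{:}A\mid-\vdash t:B$; application $t\,u$ (all with empty stoup). $\Gamma\mid z{:}\underline A\vdash z:\underline A$; $\Gamma\mid\Delta\vdash\underline{*}:\underline 1$; from $\Gamma\mid\Delta\vdash t:\underline A$, $\Gamma\mid\Delta\vdash u:\underline B$ get $\Gamma\mid\Delta\vdash\langle t,u\rangle_c:\underline A\,\&\,\underline B$, and from $\Gamma\mid\Delta\vdash t:\underline A\,\&\,\underline B$ get $\underline\pi_1t:\underline A$, $\underline\pi_2t:\underline B$; from $\Gamma,x{:}A\mid\Delta\vdash t:\underline B$ get $\Gamma\mid\Delta\vdash\underline\lambda x{:}A.t:A\Rightarrow\underline B$; from $\Gamma\mid\Delta\vdash s:A\Rightarrow\underline B$, $\Gamma\mid-\vdash t:A$ get $\Gamma\mid\Delta\vdash s@t:\underline B$; $\Gamma\mid-\vdash\top:\underline I$; from $\Gamma\mid\Delta\vdash t:\underline I$, $\Gamma\mid-\vdash u:\underline A$ get $\Gamma\mid\Delta\vdash \mathrm{let}\ \top\ \mathrm{be}\ t\ \mathrm{in}\ u:\underline A$; from $\Gamma\mid-\vdash t:A$ get $\Gamma\mid-\vdash\,!t:\,!A$; from $\Gamma\mid\Delta\vdash t:\,!A$, $\Gamma,x{:}A\mid-\vdash u:\underline B$ get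 $\Gamma\mid\Delta\vdash\mathrm{let}\ !x\ \mathrm{be}\ t\ \mathrm{in}\ u:\underline B$; from $\Gamma\mid-\vdash t:A$, $\Gamma\mid\Delta\vdash u:\underline B$ get $\Gamma\mid\Delta\vdash\,!t\otimes u:\,!A\otimes\underline B$; from $\Gamma\mid\Delta\vdash s:\,!A\otimes\underline B$, $\Gamma,x{:}A\mid y{:}\underline B\vdash t:\underline C$ get $\Gamma\mid\Delta\vdash\mathrm{let}\ !x\otimes y\ \mathrm{be}\ s\ \mathrm{in}\ t:\underline C$; from $\Gamma\mid\Delta\vdash t:\underline 0$ get $\Gamma\mid\Delta\vdash\mathrm{abort}_{\underline A}(t):\underline A$; $\mathrm{inl}\,t:\underline A\oplus\underline B$ from $t:\underline A$ and $\mathrm{inr}\,t$ from $t:\underline B$ (same $\Gamma\mid\Delta$); from $\Gamma\mid\Delta\vdash s:\underline A\oplus\underline B$, $\Gamma\mid x{:}\underline A\vdash t:\underline C$, $\Gamma\mid y{:}\underline B\vdash u:\underline C$ get $\Gamma\mid\Delta\vdash\mathrm{case}\ s\ \mathrm{of}\ (\mathrm{inl}\,x\Rightarrow t\mid\mathrm{inr}\,y\Rightarrow u):\underline C$; from $\Gamma\mid z{:}\underline A\vdash t:\underline B$ get $\Gamma\mid-\vdash\hat\lambda z{:}\underline A.t:\underline A\multimap\underline B$; from $\Gamma\mid-\vdash s:\underline A\multimap\underline B$, $\Gamma\mid\Delta\vdash t:\underline A$ get $\Gamma\mid\Delta\vdash s\{t\}:\underline B$. Equality $\Gamma\mid\Delta\vdash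 t=u:A$ is the least typed congruence (equivalence, compatible with all term formers, containing $\alpha$-equivalence) containing all well-typed instances of: $t=*$ for $t:1$; $\pi_1\langle t,u\rangle=t$, $\pi_2\langle t,u\rangle=u$, $\langle\pi_1t,\pi_2t\rangle=t$; $(\lambda x.t)u=t[u/x]$, $\lambda x.(t\,x)=t$ ($x$ not free in $t$); $t=\underline*$ for $t:\underline1$; $\underline\pi_1\langle t,u\rangle_c=t$, $\underline\pi_2\langle t,u\rangle_c=u$, $\langle\underline\pi_1t,\underline\pi_2t\rangle_c=t$; $(\underline\lambda x.t)@u=t[u/x]$, $\underline\lambda x.(t@x)=t$ ($x$ not free); $\mathrm{let}\ \top\ \mathrm{be}\ \top\ \mathrm{in}\ t=t$; $\mathrm{let}\ \top\ \mathrm{be}\ t\ \mathrm{in}\ u[\top/x]=u[t/x]$ for $\Gamma\mid x{:}\underline I\vdash u:\underline A$; $\mathrm{let}\ !x\ \mathrm{be}\ !t\ \mathrm{in}\ u=u[t/x]$; $\mathrm{let}\ !x\ \mathrm{be}\ t\ \mathrm{in}\ u[!x/y]=u[t/y]$ for $\Gamma\mid y{:}\,!A\vdash u:\underline B$; $\mathrm{let}\ !x\otimes y\ \mathrm{be}\ !t\otimes s\ \mathrm{in}\ u=u[t/x,s/y]$; $\mathrm{let}\ !x\otimes y\ \mathrm{be}\ t\ \mathrm{in}\ u[(!x\otimes y)/z]=u[t/z]$ for $\Gamma\mid z{:}\,!A\otimes\underline B\vdash u:\underline C$; $\mathrm{abort}_{\underline A}(t)=u[t/x]$ for $\Gamma\mid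 x{:}\underline 0\vdash u:\underline A$; $\mathrm{case}\ \mathrm{inl}\,t\ \mathrm{of}\ (\mathrm{inl}\,x\Rightarrow u\mid\mathrm{inr}\,y\Rightarrow u')=u[t/x]$ and symmetrically for $\mathrm{inr}$; $\mathrm{case}\ t\ \mathrm{of}\ (\mathrm{inl}\,x\Rightarrow u[\mathrm{inl}\,x/z]\mid\mathrm{inr}\,y\Rightarrow u[\mathrm{inr}\,y/z])=u[t/z]$ for $\Gamma\mid z{:}\underline A\oplus\underline B\vdash u:\underline C$; $(\hat\lambda x.t)\{u\}=t[u/x]$, $\hat\lambda x.(t\{x\})=t$ ($x$ not free). **Simply-typed $\lambda$-calculus.** Types $\sigma,\tau::=\alpha\mid 1\mid\sigma\times\tau\mid\sigma\to\tau$; terms $x,*,\langle M,N\rangle,\pi_1M,\pi_2M,\lambda x{:}\sigma.M,M\,N$ with the standard typing in contexts $\Theta=x_1{:}\sigma_1,\ldots,x_n{:}\sigma_n$. $=_{\lambda_c}$ is the equational theory of Moggi's computational $\lambda$-calculus $\lambda_c$. Each $\lambda$-calculus type constant $\alpha$ is also an EEC value-type constant. **Linear-use cbv CPS translation** (relative to $\underline R$): $\alpha^{lv}=\alpha$, $1^{lv}=1$, $(\sigma\times\tau)^{lv}=\sigma^{lv}\times\tau^{lv}$, $(\sigma\to\tau)^{lv}=\sigma^{lv}\to((\tau^{lv}\Rightarrow\underline R)\multimap\underline R)$; $\Theta^{lv}=x_1{:}\sigma_1^{lv},\ldots$. A judgement $\Theta\vdash M:\tau$ is sent to $\Theta^{lv}\mid-\vdash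 M^{lv}:(\tau^{lv}\Rightarrow\underline R)\multimap\underline R$ where: $x^{lv}=\hat\lambda k{:}\sigma^{lv}\Rightarrow\underline R.\,k@x$; $*^{lv}=\hat\lambda k{:}1\Rightarrow\underline R.\,k@*$; $\langle M,N\rangle^{lv}=\hat\lambda k{:}(\sigma^{lv}\times\tau^{lv})\Rightarrow\underline R.\,M^{lv}\{\underline\lambda x{:}\sigma^{lv}.\,N^{lv}\{\underline\lambda y{:}\tau^{lv}.\,k@\langle x,y\rangle\}\}$; $(\pi_1M)^{lv}=\hat\lambda k{:}\sigma^{lv}\Rightarrow\underline R.\,M^{lv}\{\underline\lambda z{:}\sigma^{lv}\times\tau^{lv}.\,k@(\pi_1z)\}$ and $(\pi_2M)^{lv}$ analogously with $\tau^{lv}$, $\pi_2$; $(\lambda x{:}\sigma.M)^{lv}=\hat\lambda k{:}(\sigma\to\tau)^{lv}\Rightarrow\underline R.\,k@(\lambda x{:}\sigma^{lv}.M^{lv})$; for $M:\sigma\to\tau$, $N:\sigma$: $(M\,N)^{lv}=\hat\lambda k{:}\tau^{lv}\Rightarrow\underline R.\,M^{lv}\{\underline\lambda f{:}(\sigma\to\tau)^{lv}.\,N^{lv}\{\underline\lambda x{:}\sigma^{lv}.\,(f\,x)\{k\}\}\}$. *)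

(* Defs.v *)
From Stdlib Require Import List.
Import ListNotations.

(* Syntax is intrinsically typed and uses de Bruijn indices, so that a term is
   a typed term up to renaming of bound variables, and a judgement
   "Gamma | Delta |- t : A" is the declaration [t : term Gamma Delta A]. *)

Inductive var {T : Type} : list T -> T -> Type :=
| vz {G : list T} {A : T} : var (A :: G) A
| vs {G : list T} {A B : T} : var G A -> var (B :: G) A.

Definition ren {T : Type} (G G' : list T) : Type :=
  forall A : T, var G A -> var G' A.

Definition up_ren {T : Type} {G G' : list T} {B : T} (r : ren G G') :
    ren (B :: G) (B :: G') :=
  fun A v =>
    match v in var G0 A0
      return match G0 with
             | [] => unit
             | B0 :: G1 => (forall A, var G1 A -> var G' A) -> var (B0 :: G') A0
             end
    with
    | vz => fun _ => vz
    | vs v' => fun r' => vs (r' _ v')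
    end r.

(* ------------------------------------------------------------------------ *)
(** * The enriched effect calculus *)

(* [V] and [C] are the value-type and computation-type constants.  [vcomp] is
   the inclusion of computation types in value types. *)
Inductive vty (V C : Type) : Type :=
| vconst : V -> vty V C
| vone : vty V C
| vprod : vty V C -> vty V C -> vty V C
| varr : vty V C -> vty V C -> vty V C
| vcomp : cty V C -> vty V C
| vlolli : cty V C -> cty V C -> vty V C
with cty (V C : Type) : Type :=
| cconst : C -> cty V C
| cone : cty V C
| cwith : cty V C -> cty V C -> cty V C
| cpow : vty V C -> cty V C -> cty V C       (* A => B *)
| cI : cty V C
| cbang : vty V C -> cty V C
| ctens : vty V C -> cty V C -> cty V C      (* !A (x) B *)
| czero : cty V C
| cplus : cty V C -> cty V C -> cty V C.

Arguments vconst {V C}.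
Arguments vone {V C}.
Arguments vprod {V C}.
Arguments varr {V C}.
Arguments vcomp {V C}.
Arguments vlolli {V C}.
Arguments cconst {V C}.
Arguments cone {V C}.
Arguments cwith {V C}.
Arguments cpow {V C}.
Arguments cI {V C}.
Arguments cbang {V C}.
Arguments ctens {V C}.
Arguments czero {V C}.
Arguments cplus {V C}.

Definition ctx (V C : Type) : Type := list (vty V C).
Definition stoup (V C : Type) : Type := option (cty V C).

Inductive term {V C : Type} (G : ctx V C) : stoup V C -> vty V C -> Type :=
| tvar {A} : var G A -> term G None A
| tstar : term G None vone
| tpair {A B} : term G None A -> term G None B -> term G None (vprod A B)
| tfst {A B} : term G None (vprod A B) -> term G None A
| tsnd {A B} : term G None (vprod A B) -> term G None B
| tlam {A B} : term (A :: G) None B -> term G None (varr A B)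
| tapp {A B} : term G None (varr A B) -> term G None A -> term G None B
| tsvar {A} : term G (Some A) (vcomp A)
| tcstar {D} : term G D (vcomp cone)
| tcpair {D A B} : term G D (vcomp A) -> term G D (vcomp B) ->
    term G D (vcomp (cwith A B))
| tcfst {D A B} : term G D (vcomp (cwith A B)) -> term G D (vcomp A)
| tcsnd {D A B} : term G D (vcomp (cwith A B)) -> term G D (vcomp B)
| tclam {D A B} : term (A :: G) D (vcomp B) -> term G D (vcomp (cpow A B))
| tcapp {D A B} : term G D (vcomp (cpow A B)) -> term G None A ->
    term G D (vcomp B)                                        (* s @ t *)
| ttop : term G None (vcomp cI)
| tlettop {D A} : term G D (vcomp cI) -> term G None (vcomp A) ->
    term G D (vcomp A)
| tbang {A} : term G None A -> term G None (vcomp (cbang A))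
| tletbang {D A B} : term G D (vcomp (cbang A)) ->
    term (A :: G) None (vcomp B) -> term G D (vcomp B)
| ttens {D A B} : term G None A -> term G D (vcomp B) ->
    term G D (vcomp (ctens A B))
| tlettens {D A B E} : term G D (vcomp (ctens A B)) ->
    term (A :: G) (Some B) (vcomp E) -> term G D (vcomp E)
| tabort {D A} : term G D (vcomp czero) -> term G D (vcomp A)
| tinl {D A B} : term G D (vcomp A) -> term G D (vcomp (cplus A B))
| tinr {D A B} : term G D (vcomp B) -> term G D (vcomp (cplus A B))
| tcase {D A B E} : term G D (vcomp (cplus A B)) ->
    term G (Some A) (vcomp E) -> term G (Some B) (vcomp E) ->
    term G D (vcomp E)
| tllam {A B} : term G (Some A) (vcomp B) -> term G None (vlolli A B)
| tlapp {D A B} : term G None (vlolli A B) -> term G D (vcomp A) ->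
    term G D (vcomp B).                                       (* s{t} *)

Arguments tvar {V C G A}.
Arguments tstar {V C G}.
Arguments tpair {V C G A B}.
Arguments tfst {V C G A B}.
Arguments tsnd {V C G A B}.
Arguments tlam {V C G A B}.
Arguments tapp {V C G A B}.
Arguments tsvar {V C G A}.
Arguments tcstar {V C G D}.
Arguments tcpair {V C G D A B}.
Arguments tcfst {V C G D A B}.
Arguments tcsnd {V C G D A B}.
Arguments tclam {V C G D A B}.
Arguments tcapp {V C G D A B}.
Arguments ttop {V C G}.
Arguments tlettop {V C G D A}.
Arguments tbang {V C G A}.
Arguments tletbang {V C G D A B}.
Arguments ttens {V C G D A B}.
Arguments tlettens {V C G D A B E}.
Arguments tabort {V C G D A}.
Arguments tinl {V C G D A B}.
Arguments tinr {V C G D A B}.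
Arguments tcase {V C G D A B E}.
Arguments tllam {V C G A B}.
Arguments tlapp {V C G D A B}.

Fixpoint rename {V C : Type} {G : ctx V C} {D : stoup V C} {A : vty V C}
    (t : term G D A) {G' : ctx V C} (r : ren G G') {struct t} : term G' D A :=
  match t with
  | tvar v => tvar (r _ v)
  | tstar => tstar
  | tpair t u => tpair (rename t r) (rename u r)
  | tfst t => tfst (rename t r)
  | tsnd t => tsnd (rename t r)
  | tlam t => tlam (rename t (up_ren r))
  | tapp t u => tapp (rename t r) (rename u r)
  | tsvar => tsvar
  | tcstar => tcstar
  | tcpair t u => tcpair (rename t r) (rename u r)
  | tcfst t => tcfst (rename t r)
  | tcsnd t => tcsnd (rename t r)
  | tclam t => tclam (rename t (up_ren r))
  | tcapp s t => tcapp (rename s r) (rename t r)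
  | ttop => ttop
  | tlettop t u => tlettop (rename t r) (rename u r)
  | tbang t => tbang (rename t r)
  | tletbang t u => tletbang (rename t r) (rename u (up_ren r))
  | ttens t u => ttens (rename t r) (rename u r)
  | tlettens s t => tlettens (rename s r) (rename t (up_ren r))
  | tabort t => tabort (rename t r)
  | tinl t => tinl (rename t r)
  | tinr t => tinr (rename t r)
  | tcase s t u => tcase (rename s r) (rename t r) (rename u r)
  | tllam t => tllam (rename t r)
  | tlapp s t => tlapp (rename s r) (rename t r)
  end.

Definition weaken {V C : Type} {G : ctx V C} {D : stoup V C} {A : vty V C}
    (B : vty V C) (t : term G D A) : term (B :: G) D A :=
  rename t (fun _ v => vs v).

Definition vsub {V C : Type} (G G' : ctx V C) : Type :=
  forall A : vty V C, var G A -> term G' None A.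

Definition vsub_id {V C : Type} {G : ctx V C} : vsub G G := fun _ v => tvar v.

Definition vsub_cons {V C : Type} {G G' : ctx V C} {B : vty V C}
    (u : term G' None B) (s : vsub G G') : vsub (B :: G) G' :=
  fun A v =>
    match v in var G0 A0
      return match G0 with
             | [] => unit
             | B0 :: G1 => term G' None B0 ->
                 (forall A, var G1 A -> term G' None A) -> term G' None A0
             end
    with
    | vz => fun u' _ => u'
    | vs v' => fun _ s' => s' _ v'
    end u s.

Definition up_vsub {V C : Type} {G G' : ctx V C} {B : vty V C}
    (s : vsub G G') : vsub (B :: G) (B :: G') :=
  vsub_cons (tvar vz) (fun A v => weaken B (s A v)).

(* [ssub G D D'] is a substitution for the variable (if any) of the stoup [D]
   by a term over [G | D'].  A term with empty stoup can only be sent to a term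
   with empty stoup. *)
Inductive ssub {V C : Type} (G : ctx V C) : stoup V C -> stoup V C -> Type :=
| ss_none : ssub G None None
| ss_some {A D} : term G D (vcomp A) -> ssub G (Some A) D.

Arguments ss_none {V C G}.
Arguments ss_some {V C G A D}.

Definition ssub_id {V C : Type} {G : ctx V C} (D : stoup V C) : ssub G D D :=
  match D with
  | None => ss_none
  | Some _ => ss_some tsvar
  end.

Definition ssub_weaken {V C : Type} {G : ctx V C} {D D' : stoup V C}
    (B : vty V C) (d : ssub G D D') : ssub (B :: G) D D' :=
  match d with
  | ss_none => ss_none
  | ss_some t => ss_some (weaken B t)
  end.

Definition ssub_term {V C : Type} {G : ctx V C} {A : cty V C} {D : stoup V C}
    (d : ssub G (Some A) D) : term G D (vcomp A) :=
  match d in ssub _ D0 D1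
    return match D0 with None => unit | Some A0 => term G D1 (vcomp A0) end
  with
  | ss_none => tt
  | ss_some t => t
  end.

Definition ssub_none {V C : Type} {G : ctx V C} {D : stoup V C} {A : vty V C}
    (d : ssub G None D) : term G None A -> term G D A :=
  match d in ssub _ D0 D1
    return match D0 with
           | None => term G None A -> term G D1 A
           | Some _ => unit
           end
  with
  | ss_none => fun t => t
  | ss_some _ => tt
  end.

Fixpoint subst {V C : Type} {G : ctx V C} {D : stoup V C} {A : vty V C}
    (t : term G D A) {struct t} :
    forall (G' : ctx V C) (D' : stoup V C),
      vsub G G' -> ssub G' D D' -> term G' D' A :=
  match t in term _ D0 A0
    return forall (G' : ctx V C) (D' : stoup V C),
      vsub G G' -> ssub G' D0 D' -> term G' D' A0
  with
  | tvar v => fun _ _ s d => ssub_none d (s _ v)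
  | tstar => fun _ _ s d => ssub_none d tstar
  | tpair t u => fun _ _ s d =>
      ssub_none d (tpair (subst t _ _ s ss_none) (subst u _ _ s ss_none))
  | tfst t => fun _ _ s d => ssub_none d (tfst (subst t _ _ s ss_none))
  | tsnd t => fun _ _ s d => ssub_none d (tsnd (subst t _ _ s ss_none))
  | tlam t => fun _ _ s d => ssub_none d (tlam (subst t _ _ (up_vsub s) ss_none))
  | tapp t u => fun _ _ s d =>
      ssub_none d (tapp (subst t _ _ s ss_none) (subst u _ _ s ss_none))
  | tsvar => fun _ _ s d => ssub_term d
  | tcstar => fun _ _ s d => tcstar
  | tcpair t u => fun _ _ s d => tcpair (subst t _ _ s d) (subst u _ _ s d)
  | tcfst t => fun _ _ s d => tcfst (subst t _ _ s d)
  | tcsnd t => fun _ _ s d => tcsnd (subst t _ _ s d)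
  | tclam t => fun _ _ s d =>
      tclam (subst t _ _ (up_vsub s) (ssub_weaken _ d))
  | tcapp t u => fun _ _ s d => tcapp (subst t _ _ s d) (subst u _ _ s ss_none)
  | ttop => fun _ _ s d => ssub_none d ttop
  | tlettop t u => fun _ _ s d =>
      tlettop (subst t _ _ s d) (subst u _ _ s ss_none)
  | tbang t => fun _ _ s d => ssub_none d (tbang (subst t _ _ s ss_none))
  | tletbang t u => fun _ _ s d =>
      tletbang (subst t _ _ s d) (subst u _ _ (up_vsub s) ss_none)
  | ttens t u => fun _ _ s d => ttens (subst t _ _ s ss_none) (subst u _ _ s d)
  | tlettens t u => fun _ _ s d =>
      tlettens (subst t _ _ s d) (subst u _ _ (up_vsub s) (ss_some tsvar))
  | tabort t => fun _ _ s d => tabort (subst t _ _ s d)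
  | tinl t => fun _ _ s d => tinl (subst t _ _ s d)
  | tinr t => fun _ _ s d => tinr (subst t _ _ s d)
  | tcase t u w => fun _ _ s d =>
      tcase (subst t _ _ s d)
        (subst u _ _ s (ss_some tsvar)) (subst w _ _ s (ss_some tsvar))
  | tllam t => fun _ _ s d =>
      ssub_none d (tllam (subst t _ _ s (ss_some tsvar)))
  | tlapp t u => fun _ _ s d => tlapp (subst t _ _ s ss_none) (subst u _ _ s d)
  end.

(* t[u/x], with x the last variable of the context *)
Definition subst1 {V C : Type} {G : ctx V C} {D : stoup V C} {A B : vty V C}
    (t : term (B :: G) D A) (u : term G None B) : term G D A :=
  subst t G D (vsub_cons u vsub_id) (ssub_id D).

(* t[u/z], with z the stoup variable *)
Definition subst_stoup {V C : Type} {G : ctx V C} {D : stoup V C} {A : vty V C}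
    {B : cty V C} (t : term G (Some B) A) (u : term G D (vcomp B)) :
    term G D A :=
  subst t G D vsub_id (ss_some u).

(* t[u/x, w/z], with x the last variable of the context and z the stoup *)
Definition subst2 {V C : Type} {G : ctx V C} {D : stoup V C} {A B : vty V C}
    {E : cty V C} (t : term (B :: G) (Some E) A) (u : term G None B)
    (w : term G D (vcomp E)) : term G D A :=
  subst t G D (vsub_cons u vsub_id) (ss_some w).

Inductive eec_eq {V C : Type} :
    forall {G : ctx V C} {D : stoup V C} {A : vty V C},
      term G D A -> term G D A -> Prop :=
| eec_refl {G D A} (t : term G D A) : eec_eq t t
| eec_sym {G D A} (t u : term G D A) : eec_eq t u -> eec_eq u t
| eec_trans {G D A} (t u w : term G D A) :
    eec_eq t u -> eec_eq u w -> eec_eq t w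

| eec_pair {G A B} (t t' : term G None A) (u u' : term G None B) :
    eec_eq t t' -> eec_eq u u' -> eec_eq (tpair t u) (tpair t' u')
| eec_fst {G A B} (t t' : term G None (vprod A B)) :
    eec_eq t t' -> eec_eq (tfst t) (tfst t')
| eec_snd {G A B} (t t' : term G None (vprod A B)) :
    eec_eq t t' -> eec_eq (tsnd t) (tsnd t')
| eec_lam {G A B} (t t' : term (A :: G) None B) :
    eec_eq t t' -> eec_eq (tlam t) (tlam t')
| eec_app {G A B} (t t' : term G None (varr A B)) (u u' : term G None A) :
    eec_eq t t' -> eec_eq u u' -> eec_eq (tapp t u) (tapp t' u')
| eec_cpair {G D A B} (t t' : term G D (vcomp A)) (u u' : term G D (vcomp B)) :
    eec_eq t t' -> eec_eq u u' -> eec_eq (tcpair t u) (tcpair t' u')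
| eec_cfst {G D A B} (t t' : term G D (vcomp (cwith A B))) :
    eec_eq t t' -> eec_eq (tcfst t) (tcfst t')
| eec_csnd {G D A B} (t t' : term G D (vcomp (cwith A B))) :
    eec_eq t t' -> eec_eq (tcsnd t) (tcsnd t')
| eec_clam {G D A B} (t t' : term (A :: G) D (vcomp B)) :
    eec_eq t t' -> eec_eq (tclam t) (tclam t')
| eec_capp {G D A B} (t t' : term G D (vcomp (cpow A B))) (u u' : term G None A) :
    eec_eq t t' -> eec_eq u u' -> eec_eq (tcapp t u) (tcapp t' u')
| eec_lettop {G D A} (t t' : term G D (vcomp cI)) (u u' : term G None (vcomp A)) :
    eec_eq t t' -> eec_eq u u' -> eec_eq (tlettop t u) (tlettop t' u')
| eec_bang {G A} (t t' : term G None A) :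
    eec_eq t t' -> eec_eq (tbang t) (tbang t')
| eec_letbang {G D A B} (t t' : term G D (vcomp (cbang A)))
    (u u' : term (A :: G) None (vcomp B)) :
    eec_eq t t' -> eec_eq u u' -> eec_eq (tletbang t u) (tletbang t' u')
| eec_tens {G D A B} (t t' : term G None A) (u u' : term G D (vcomp B)) :
    eec_eq t t' -> eec_eq u u' -> eec_eq (ttens t u) (ttens t' u')
| eec_lettens {G D A B E} (t t' : term G D (vcomp (ctens A B)))
    (u u' : term (A :: G) (Some B) (vcomp E)) :
    eec_eq t t' -> eec_eq u u' -> eec_eq (tlettens t u) (tlettens t' u')
| eec_abort {G D A} (t t' : term G D (vcomp czero)) :
    eec_eq t t' -> eec_eq (@tabort _ _ _ _ A t) (tabort t')
| eec_inl {G D A B} (t t' : term G D (vcomp A)) :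
    eec_eq t t' -> eec_eq (@tinl _ _ _ _ A B t) (tinl t')
| eec_inr {G D A B} (t t' : term G D (vcomp B)) :
    eec_eq t t' -> eec_eq (@tinr _ _ _ _ A B t) (tinr t')
| eec_case {G D A B E} (t t' : term G D (vcomp (cplus A B)))
    (u u' : term G (Some A) (vcomp E)) (w w' : term G (Some B) (vcomp E)) :
    eec_eq t t' -> eec_eq u u' -> eec_eq w w' ->
    eec_eq (tcase t u w) (tcase t' u' w')
| eec_llam {G A B} (t t' : term G (Some A) (vcomp B)) :
    eec_eq t t' -> eec_eq (tllam t) (tllam t')
| eec_lapp {G D A B} (t t' : term G None (vlolli A B)) (u u' : term G D (vcomp A)) :
    eec_eq t t' -> eec_eq u u' -> eec_eq (tlapp t u) (tlapp t' u')

| eec_one_eta {G} (t : term G None vone) : eec_eq t tstar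
| eec_fst_beta {G A B} (t : term G None A) (u : term G None B) :
    eec_eq (tfst (tpair t u)) t
| eec_snd_beta {G A B} (t : term G None A) (u : term G None B) :
    eec_eq (tsnd (tpair t u)) u
| eec_pair_eta {G A B} (t : term G None (vprod A B)) :
    eec_eq (tpair (tfst t) (tsnd t)) t
| eec_lam_beta {G A B} (t : term (A :: G) None B) (u : term G None A) :
    eec_eq (tapp (tlam t) u) (subst1 t u)
| eec_lam_eta {G A B} (t : term G None (varr A B)) :
    eec_eq (tlam (tapp (weaken A t) (tvar vz))) t
| eec_cone_eta {G D} (t : term G D (vcomp cone)) : eec_eq t tcstar
| eec_cfst_beta {G D A B} (t : term G D (vcomp A)) (u : term G D (vcomp B)) :
    eec_eq (tcfst (tcpair t u)) t
| eec_csnd_beta {G D A B} (t : term G D (vcomp A)) (u : term G D (vcomp B)) :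
    eec_eq (tcsnd (tcpair t u)) u
| eec_cpair_eta {G D A B} (t : term G D (vcomp (cwith A B))) :
    eec_eq (tcpair (tcfst t) (tcsnd t)) t
| eec_clam_beta {G D A B} (t : term (A :: G) D (vcomp B)) (u : term G None A) :
    eec_eq (tcapp (tclam t) u) (subst1 t u)
| eec_clam_eta {G D A B} (t : term G D (vcomp (cpow A B))) :
    eec_eq (tclam (tcapp (weaken A t) (tvar vz))) t
| eec_top_beta {G A} (t : term G None (vcomp A)) :
    eec_eq (tlettop ttop t) t
| eec_top_eta {G D A} (t : term G D (vcomp cI)) (u : term G (Some cI) (vcomp A)) :
    eec_eq (tlettop t (subst_stoup u ttop)) (subst_stoup u t)
| eec_bang_beta {G A B} (t : term G None A) (u : term (A :: G) None (vcomp B)) :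
    eec_eq (tletbang (tbang t) u) (subst1 u t)
| eec_bang_eta {G D A B} (t : term G D (vcomp (cbang A)))
    (u : term G (Some (cbang A)) (vcomp B)) :
    eec_eq (tletbang t (subst_stoup (weaken A u) (tbang (tvar vz))))
           (subst_stoup u t)
| eec_tens_beta {G D A B E} (t : term G None A) (s : term G D (vcomp B))
    (u : term (A :: G) (Some B) (vcomp E)) :
    eec_eq (tlettens (ttens t s) u) (subst2 u t s)
| eec_tens_eta {G D A B E} (t : term G D (vcomp (ctens A B)))
    (u : term G (Some (ctens A B)) (vcomp E)) :
    eec_eq (tlettens t (subst_stoup (weaken A u) (ttens (tvar vz) tsvar)))
           (subst_stoup u t)
| eec_zero_eta {G D A} (t : term G D (vcomp czero))
    (u : term G (Some czero) (vcomp A)) :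
    eec_eq (tabort t) (subst_stoup u t)
| eec_inl_beta {G D A B E} (t : term G D (vcomp A))
    (u : term G (Some A) (vcomp E)) (w : term G (Some B) (vcomp E)) :
    eec_eq (tcase (tinl t) u w) (subst_stoup u t)
| eec_inr_beta {G D A B E} (t : term G D (vcomp B))
    (u : term G (Some A) (vcomp E)) (w : term G (Some B) (vcomp E)) :
    eec_eq (tcase (tinr t) u w) (subst_stoup w t)
| eec_plus_eta {G D A B E} (t : term G D (vcomp (cplus A B)))
    (u : term G (Some (cplus A B)) (vcomp E)) :
    eec_eq (tcase t (subst_stoup u (tinl tsvar)) (subst_stoup u (tinr tsvar)))
           (subst_stoup u t)
| eec_llam_beta {G D A B} (t : term G (Some A) (vcomp B)) (u : term G D (vcomp A)) :
    eec_eq (tlapp (tllam t) u) (subst_stoup t u)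
| eec_llam_eta {G A B} (t : term G None (vlolli A B)) :
    eec_eq (tllam (tlapp t tsvar)) t.

(* ------------------------------------------------------------------------ *)
(** * Simply-typed lambda-calculus and the computational lambda-calculus *)

Inductive sty (L : Type) : Type :=
| sconst : L -> sty L
| sone : sty L
| sprod : sty L -> sty L -> sty L
| sarr : sty L -> sty L -> sty L.

Arguments sconst {L}.
Arguments sone {L}.
Arguments sprod {L}.
Arguments sarr {L}.

Inductive tm {L : Type} (H : list (sty L)) : sty L -> Type :=
| mvar {a} : var H a -> tm H a
| mstar : tm H sone
| mpair {a b} : tm H a -> tm H b -> tm H (sprod a b)
| mfst {a b} : tm H (sprod a b) -> tm H a
| msnd {a b} : tm H (sprod a b) -> tm H b
| mlam {a b} : tm (a :: H) b -> tm H (sarr a b)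
| mapp {a b} : tm H (sarr a b) -> tm H a -> tm H b.

Arguments mvar {L H a}.
Arguments mstar {L H}.
Arguments mpair {L H a b}.
Arguments mfst {L H a b}.
Arguments msnd {L H a b}.
Arguments mlam {L H a b}.
Arguments mapp {L H a b}.

Fixpoint mrename {L : Type} {H : list (sty L)} {a : sty L} (M : tm H a)
    {H' : list (sty L)} (r : ren H H') {struct M} : tm H' a :=
  match M with
  | mvar v => mvar (r _ v)
  | mstar => mstar
  | mpair M N => mpair (mrename M r) (mrename N r)
  | mfst M => mfst (mrename M r)
  | msnd M => msnd (mrename M r)
  | mlam M => mlam (mrename M (up_ren r))
  | mapp M N => mapp (mrename M r) (mrename N r)
  end.

Definition mweaken {L : Type} {H : list (sty L)} {a : sty L} (b : sty L)
    (M : tm H a) : tm (b :: H) a :=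
  mrename M (fun _ v => vs v).

Definition msub {L : Type} (H H' : list (sty L)) : Type :=
  forall a : sty L, var H a -> tm H' a.

Definition msub_cons {L : Type} {H H' : list (sty L)} {b : sty L}
    (N : tm H' b) (s : msub H H') : msub (b :: H) H' :=
  fun a v =>
    match v in var H0 a0
      return match H0 with
             | [] => unit
             | b0 :: H1 => tm H' b0 -> (forall a, var H1 a -> tm H' a) -> tm H' a0
             end
    with
    | vz => fun N' _ => N'
    | vs v' => fun _ s' => s' _ v'
    end N s.

Definition up_msub {L : Type} {H H' : list (sty L)} {b : sty L}
    (s : msub H H') : msub (b :: H) (b :: H') :=
  msub_cons (mvar vz) (fun a v => mweaken b (s a v)).

Fixpoint msubst {L : Type} {H : list (sty L)} {a : sty L} (M : tm H a)
    {H' : list (sty L)} (s : msub H H') {struct M} : tm H' a :=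
  match M with
  | mvar v => s _ v
  | mstar => mstar
  | mpair M N => mpair (msubst M s) (msubst N s)
  | mfst M => mfst (msubst M s)
  | msnd M => msnd (msubst M s)
  | mlam M => mlam (msubst M (up_msub s))
  | mapp M N => mapp (msubst M s) (msubst N s)
  end.

Definition msubst1 {L : Type} {H : list (sty L)} {a b : sty L}
    (M : tm (b :: H) a) (N : tm H b) : tm H a :=
  msubst M (msub_cons N (fun _ v => mvar v)).

Definition mlet {L : Type} {H : list (sty L)} {a b : sty L}
    (M : tm H a) (N : tm (a :: H) b) : tm H b :=
  mapp (mlam N) M.

Inductive is_value {L : Type} {H : list (sty L)} :
    forall {a : sty L}, tm H a -> Prop :=
| val_var {a} (v : var H a) : is_value (mvar v)
| val_star : is_value mstar
| val_pair {a b} (M : tm H a) (N : tm H b) :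
    is_value M -> is_value N -> is_value (mpair M N)
| val_fst {a b} (M : tm H (sprod a b)) : is_value M -> is_value (mfst M)
| val_snd {a b} (M : tm H (sprod a b)) : is_value M -> is_value (msnd M)
| val_lam {a b} (M : tm (a :: H) b) : is_value (mlam M).

(* Moggi's theory for this let-free syntax, with "let x be M in N" read as
   (fun x => N) M; evaluation is call-by-value, from left to right. *)
Inductive lc_eq {L : Type} :
    forall {H : list (sty L)} {a : sty L}, tm H a -> tm H a -> Prop :=
| lc_refl {H a} (M : tm H a) : lc_eq M M
| lc_sym {H a} (M N : tm H a) : lc_eq M N -> lc_eq N M
| lc_trans {H a} (M N P : tm H a) : lc_eq M N -> lc_eq N P -> lc_eq M P

| lc_pair {H a b} (M M' : tm H a) (N N' : tm H b) :
    lc_eq M M' -> lc_eq N N' -> lc_eq (mpair M N) (mpair M' N')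
| lc_fst {H a b} (M M' : tm H (sprod a b)) :
    lc_eq M M' -> lc_eq (mfst M) (mfst M')
| lc_snd {H a b} (M M' : tm H (sprod a b)) :
    lc_eq M M' -> lc_eq (msnd M) (msnd M')
| lc_lam {H a b} (M M' : tm (a :: H) b) :
    lc_eq M M' -> lc_eq (mlam M) (mlam M')
| lc_app {H a b} (M M' : tm H (sarr a b)) (N N' : tm H a) :
    lc_eq M M' -> lc_eq N N' -> lc_eq (mapp M N) (mapp M' N')

| lc_one_eta {H} (M : tm H sone) : is_value M -> lc_eq M mstar
| lc_fst_beta {H a b} (M : tm H a) (N : tm H b) :
    is_value M -> is_value N -> lc_eq (mfst (mpair M N)) M
| lc_snd_beta {H a b} (M : tm H a) (N : tm H b) :
    is_value M -> is_value N -> lc_eq (msnd (mpair M N)) N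
| lc_pair_eta {H a b} (M : tm H (sprod a b)) :
    is_value M -> lc_eq (mpair (mfst M) (msnd M)) M
| lc_lam_beta {H a b} (M : tm (a :: H) b) (N : tm H a) :
    is_value N -> lc_eq (mapp (mlam M) N) (msubst1 M N)
| lc_lam_eta {H a b} (M : tm H (sarr a b)) :
    is_value M -> lc_eq (mlam (mapp (mweaken a M) (mvar vz))) M

| lc_let_unit {H a} (M : tm H a) : lc_eq (mlet M (mvar vz)) M
| lc_let_assoc {H a b c} (M : tm H a) (N : tm (a :: H) b) (P : tm (b :: H) c) :
    lc_eq (mlet (mlet M N) P)
          (mlet M (mlet N (mrename P (up_ren (fun _ v => vs v)))))
| lc_let_pair {H a b} (M : tm H a) (N : tm H b) :
    lc_eq (mpair M N)
          (mlet M (mlet (mweaken a N) (mpair (mvar (vs vz)) (mvar vz))))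
| lc_let_fst {H a b} (M : tm H (sprod a b)) :
    lc_eq (mfst M) (mlet M (mfst (mvar vz)))
| lc_let_snd {H a b} (M : tm H (sprod a b)) :
    lc_eq (msnd M) (mlet M (msnd (mvar vz)))
| lc_let_app {H a b} (M : tm H (sarr a b)) (N : tm H a) :
    lc_eq (mapp M N)
          (mlet M (mlet (mweaken _ N) (mapp (mvar (vs vz)) (mvar vz)))).

(* ------------------------------------------------------------------------ *)
(** * The linear-use call-by-value CPS translation *)

(* [incl] includes the type constants of the lambda-calculus in the value-type
   constants of EEC; [R] is the result type. *)

Definition lcont {V C : Type} (R : cty V C) (A : vty V C) : vty V C :=
  vlolli (cpow A R) R.                                  (* (A => R) -o R *)

Fixpoint lvty {L V C : Type} (incl : L -> V) (R : cty V C) (a : sty L) :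
    vty V C :=
  match a with
  | sconst c => vconst (incl c)
  | sone => vone
  | sprod a b => vprod (lvty incl R a) (lvty incl R b)
  | sarr a b => varr (lvty incl R a) (lcont R (lvty incl R b))
  end.

Definition lvctx {L V C : Type} (incl : L -> V) (R : cty V C)
    (H : list (sty L)) : ctx V C :=
  map (lvty incl R) H.

Fixpoint lvvar {L V C : Type} (incl : L -> V) (R : cty V C)
    {H : list (sty L)} {a : sty L} (v : var H a) :
    var (lvctx incl R H) (lvty incl R a) :=
  match v with
  | vz => vz
  | vs v' => vs (lvvar incl R v')
  end.

Fixpoint lvtm {L V C : Type} (incl : L -> V) (R : cty V C)
    {H : list (sty L)} {a : sty L} (M : tm H a) {struct M} :
    term (lvctx incl R H) None (lcont R (lvty incl R a)) :=
  match M with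
  | mvar v => tllam (tcapp tsvar (tvar (lvvar incl R v)))
  | mstar => tllam (tcapp tsvar tstar)
  | mpair M N =>
      tllam (tlapp (lvtm incl R M)
        (tclam (tlapp (weaken _ (lvtm incl R N))
          (tclam (tcapp tsvar (tpair (tvar (vs vz)) (tvar vz)))))))
  | mfst M =>
      tllam (tlapp (lvtm incl R M) (tclam (tcapp tsvar (tfst (tvar vz)))))
  | msnd M =>
      tllam (tlapp (lvtm incl R M) (tclam (tcapp tsvar (tsnd (tvar vz)))))
  | mlam M => tllam (tcapp tsvar (tlam (lvtm incl R M)))
  | mapp M N =>
      tllam (tlapp (lvtm incl R M)
        (tclam (tlapp (weaken _ (lvtm incl R N))
          (tclam (tlapp (tapp (tvar (vs vz)) (tvar vz)) tsvar)))))
  end.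

(* Main.v *)
Require Import Defs.
From Stdlib Require Import List FunctionalExtensionality Program.Equality Eqdep.
From Stdlib Require Import Lia.
Import ListNotations.

(**
Fullness is a Kripke logical predicate argument.  Value types carry predicates
on terms; a computation type [A] carries a predicate on its observations
[z : A |- s : R], so that computation types are interpreted contravariantly:
[A => B] and [A & B] are generated from the observations of their components
under "run [M^lv], then observe", while [!A], [!A (x) B], [A (+) B] are defined
by their elimination behaviour.  The observations of [R] are generated by [z].
Then a term satisfies the predicate at [a^lv] exactly when [k |-> k @ t] is some
[M^lv], and the predicate at [(a^lv => R) -o R] exactly when it is some [M^lv].

Faithfulness only needs the degenerate model of EEC in sets where every function
is linear and the unit [I] and the constants all denote one set, taken to be
families of sets of lambda-terms.  In it the translation becomes the ordinary
call-by-value CPS translation, and [M] is recovered up to [lc_eq] from the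
denotation of [M^lv] by normalisation by evaluation.
*)

(** * Substitution in EEC *)

(** Observations suit the target [(a => R) -o R] because it is a type of linear maps: precomposition
    turns observations of [R] into observations of [a => R], and the observation [z] of [R] alone
    already gives back the whole map, up to eta. Closing under [bind] costs nothing, since a
    computation run first is a [let] of the lambda-calculus; but it works under a new variable, so
    worlds have to grow. A term of computation type with empty stoup has no variable to be observed
    through. It is treated as a linear map out of [I], which is why closed answers are described
    through [I] whatever [R] is.

    In the set model a denotation knows neither a context nor a result type, whereas reading back a
    term needs both: fresh variables must be named, and a continuation may end in any type. Both
    indices are therefore moved into the answers. Answers are sets of terms, so that one can work up
    to [lc_eq] without quotients and leave a set empty where a variable is out of scope. *)

Local Ltac rewrite_hyps :=
  repeat match goal with
  | IH : forall _, _ |- _ => rewrite IH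
  end.

Section Renamings.

Context {T : Type}.

Lemma up_ren_id (G : list T) (B : T) :
  up_ren (fun A (v : var G A) => v) = (fun A (v : var (B :: G) A) => v).
Proof.
  extensionality A; extensionality v; dependent destruction v; reflexivity.
Qed.

Lemma up_ren_comp (G G' G'' : list T) (B : T) (r : ren G G') (r' : ren G' G'') :
  (fun A (v : var (B :: G) A) => up_ren r' A (up_ren r A v)) =
  up_ren (fun A v => r' A (r A v)).
Proof.
  extensionality A; extensionality v; dependent destruction v; reflexivity.
Qed.

End Renamings.

Section Substitution.

Context {V C : Type}.
Implicit Types (G : ctx V C) (D : stoup V C).

Definition ssub_rename {G G' D D'} (r : ren G G') (d : ssub G D D') :
    ssub G' D D' :=
  match d with
  | ss_none => ss_none
  | ss_some t => ss_some (rename t r)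
  end.

Definition ssub_comp {G G' D D' D''} (d : ssub G D D') (s : vsub G G')
    (d' : ssub G' D' D'') : ssub G' D D'' :=
  match d in ssub _ D0 D1 return ssub G' D1 D'' -> ssub G' D0 D'' with
  | ss_none => fun d' => d'
  | ss_some t => fun d' => ss_some (subst t _ _ s d')
  end d'.

Lemma rename_id {G D A} (t : term G D A) : rename t (fun _ v => v) = t.
Proof.
  induction t; cbn [rename]; rewrite ?up_ren_id; congruence.
Qed.

Lemma rename_rename {G D A} (t : term G D A) : forall G' G''
    (r : ren G G') (r' : ren G' G''),
  rename (rename t r) r' = rename t (fun _ v => r' _ (r _ v)).
Proof.
  induction t; intros G' G'' r r'; cbn [rename]; rewrite_hyps;
    rewrite ?up_ren_comp; reflexivity.
Qed.

Lemma vsub_cons_up_ren {G G' G'' B} (u : term G'' None B) (r : ren G G')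
    (s : vsub G' G'') :
  (fun A v => vsub_cons u s A (up_ren r A v)) =
  vsub_cons u (fun A v => s A (r A v)).
Proof.
  extensionality A; extensionality v; dependent destruction v; reflexivity.
Qed.

Lemma ssub_weaken_rename {G D D'} B (d : ssub G D D') :
  ssub_weaken B d = ssub_rename (fun _ v => vs v) d.
Proof. destruct d; reflexivity. Qed.

Lemma subst_rename {G D A} (t : term G D A) : forall G' G'' D'
    (r : ren G G') (s : vsub G' G'') (d : ssub G'' D D'),
  subst (rename t r) _ _ s d = subst t _ _ (fun _ v => s _ (r _ v)) d.
Proof.
  induction t; intros G' G'' D' r s d; cbn [rename subst]; rewrite_hyps;
    unfold up_vsub; rewrite ?vsub_cons_up_ren; reflexivity.
Qed.

Lemma vsub_cons_rename {G G' G'' B} (u : term G' None B) (s : vsub G G')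
    (r : ren G' G'') :
  (fun A v => rename (vsub_cons u s A v) r) =
  vsub_cons (rename u r) (fun A v => rename (s A v) r).
Proof.
  extensionality A; extensionality v; dependent destruction v; reflexivity.
Qed.

Lemma up_vsub_rename {G G' G'' B} (s : vsub G G') (r : ren G' G'') :
  up_vsub (B := B) (fun A v => rename (s A v) r) =
  (fun A v => rename (up_vsub s A v) (up_ren r)).
Proof.
  unfold up_vsub; rewrite vsub_cons_rename; cbn [rename up_ren]; f_equal.
  extensionality A; extensionality v; unfold weaken.
  rewrite !rename_rename; reflexivity.
Qed.

Lemma ssub_rename_weaken {G G' D D' B} (d : ssub G D D') (r : ren G G') :
  ssub_weaken B (ssub_rename r d) = ssub_rename (up_ren r) (ssub_weaken B d).
Proof.
  destruct d; cbn; unfold weaken; rewrite ?rename_rename; reflexivity.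
Qed.

Lemma rename_subst {G D A} (t : term G D A) : forall G' G'' D'
    (s : vsub G G') (d : ssub G' D D') (r : ren G' G''),
  rename (subst t _ _ s d) r =
  subst t _ _ (fun _ v => rename (s _ v) r) (ssub_rename r d).
Proof.
  induction t; intros G' G'' D' s d r; cbn [subst];
    (* The pattern [[idtac]] keeps the case split only if a single case survives, that is, when the
       typing rule fixes whether the stoup is empty. *)
    try (dependent destruction d; [idtac]); cbn [ssub_none ssub_term rename];
    rewrite_hyps; rewrite <- ?up_vsub_rename, <- ?ssub_rename_weaken;
    reflexivity.
Qed.

Lemma vsub_cons_subst {G G' G'' B} (u : term G' None B) (s : vsub G G')
    (s' : vsub G' G'') :
  (fun A v => subst (vsub_cons u s A v) _ _ s' ss_none) =
  vsub_cons (subst u _ _ s' ss_none)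
    (fun A v => subst (s A v) _ _ s' ss_none).
Proof.
  extensionality A; extensionality v; dependent destruction v; reflexivity.
Qed.

Lemma subst_weaken {G G' D D' A B} (t : term G D A) (u : term G' None B)
    (s : vsub G G') (d : ssub G' D D') :
  subst (weaken B t) _ _ (vsub_cons u s) d = subst t _ _ s d.
Proof. apply subst_rename. Qed.

Lemma up_vsub_subst {G G' G'' B} (s : vsub G G') (s' : vsub G' G'') :
  (fun A v => subst (up_vsub (B := B) s A v) _ _ (up_vsub s') ss_none) =
  up_vsub (fun A v => subst (s A v) _ _ s' ss_none).
Proof.
  unfold up_vsub at 1; rewrite vsub_cons_subst.
  unfold up_vsub at 3; cbn [subst]; f_equal.
  extensionality A; extensionality v; unfold up_vsub.
  rewrite subst_weaken; unfold weaken; rewrite rename_subst; reflexivity.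
Qed.

Lemma ssub_comp_weaken {G G' D D' D'' B} (d : ssub G D D') (s : vsub G G')
    (d' : ssub G' D' D'') :
  ssub_comp (ssub_weaken B d) (up_vsub s) (ssub_weaken B d') =
  ssub_weaken B (ssub_comp d s d').
Proof.
  destruct d; cbn; [reflexivity|]; f_equal; unfold up_vsub.
  rewrite subst_weaken; unfold weaken; rewrite rename_subst.
  rewrite ssub_weaken_rename; reflexivity.
Qed.

Lemma subst_subst {G D A} (t : term G D A) : forall G' G'' D' D''
    (s : vsub G G') (d : ssub G' D D') (s' : vsub G' G'')
    (d' : ssub G'' D' D''),
  subst (subst t _ _ s d) _ _ s' d' =
  subst t _ _ (fun _ v => subst (s _ v) _ _ s' ss_none) (ssub_comp d s' d').
Proof.
  induction t; intros G' G'' D' D'' s d s' d'; cbn [subst];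
    try (dependent destruction d; [idtac]);
    try (dependent destruction d'; [idtac]);
    cbn [ssub_none ssub_term subst ssub_comp];
    rewrite_hyps; rewrite ?up_vsub_subst, ?ssub_comp_weaken; try reflexivity.
Qed.

Lemma up_vsub_id G B : up_vsub (B := B) (@vsub_id _ _ G) = vsub_id.
Proof.
  extensionality A; extensionality v; dependent destruction v; reflexivity.
Qed.

Lemma ssub_weaken_id G D B : ssub_weaken B (@ssub_id _ _ G D) = ssub_id D.
Proof. destruct D; reflexivity. Qed.

Lemma subst_id {G D A} (t : term G D A) : subst t _ _ vsub_id (ssub_id D) = t.
Proof.
  induction t; cbn [subst ssub_id ssub_none ssub_term] in *;
    rewrite ?up_vsub_id, ?ssub_weaken_id; reflexivity || congruence.
Qed.

Lemma subst_none_id {G A} (t : term G None A) : subst t _ _ vsub_id ss_none = t.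
Proof. exact (subst_id t). Qed.

Lemma subst_stoup_id {G A B} (t : term G (Some A) B) :
  subst_stoup t tsvar = t.
Proof. exact (subst_id t). Qed.

Lemma subst_stoup_stoup {G D A B E} (t : term G (Some B) A)
    (u : term G (Some E) (vcomp B)) (w : term G D (vcomp E)) :
  subst_stoup (subst_stoup t u) w = subst_stoup t (subst_stoup u w).
Proof. unfold subst_stoup; rewrite subst_subst; reflexivity. Qed.

Lemma weaken_rename {G G' D A B} (t : term G D A) (r : ren G G') :
  weaken B (rename t r) = rename (weaken B t) (up_ren r).
Proof. unfold weaken; rewrite !rename_rename; reflexivity. Qed.

Lemma subst1_weaken {G D A B} (t : term G D A) (u : term G None B) :
  subst1 (weaken B t) u = t.
Proof. unfold subst1; rewrite subst_weaken; apply subst_id. Qed.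

Lemma ssub_rename_id {G G' D} (r : ren G G') :
  ssub_rename r (ssub_id D) = ssub_id D.
Proof. destruct D; reflexivity. Qed.

Lemma rename_subst1 {G G' D A B} (t : term (B :: G) D A) (u : term G None B)
    (r : ren G G') :
  rename (subst1 t u) r = subst1 (rename t (up_ren r)) (rename u r).
Proof.
  unfold subst1; rewrite rename_subst, subst_rename, vsub_cons_rename.
  rewrite vsub_cons_up_ren, ssub_rename_id; reflexivity.
Qed.

Lemma rename_subst_stoup {G G' D A B} (t : term G (Some B) A)
    (u : term G D (vcomp B)) (r : ren G G') :
  rename (subst_stoup t u) r = subst_stoup (rename t r) (rename u r).
Proof. unfold subst_stoup; rewrite rename_subst, subst_rename; reflexivity. Qed.

Lemma rename_subst2 {G G' D A B E} (t : term (B :: G) (Some E) A)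
    (u : term G None B) (w : term G D (vcomp E)) (r : ren G G') :
  rename (subst2 t u w) r =
  subst2 (rename t (up_ren r)) (rename u r) (rename w r).
Proof.
  unfold subst2; rewrite rename_subst, subst_rename, vsub_cons_rename.
  rewrite vsub_cons_up_ren; reflexivity.
Qed.

Lemma eec_eq_rename {G D A} (t u : term G D A) : eec_eq t u ->
  forall G' (r : ren G G'), eec_eq (rename t r) (rename u r).
Proof.
  induction 1; intros G' r; cbn [rename];
    try (econstructor; eauto; fail);
    rewrite ?rename_subst1, ?rename_subst_stoup, ?rename_subst2, <- ?weaken_rename;
    cbn [rename up_ren]; try (constructor; fail).
Qed.

(** Beta for [tllam] turns stoup substitution into an application, so the congruence rules of
    [tllam] and [tlapp] replace an induction on derivations. *)
Lemma eec_eq_subst_stoup {G D A B} (t t' : term G (Some A) (vcomp B))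
    (u u' : term G D (vcomp A)) :
  eec_eq t t' -> eec_eq u u' -> eec_eq (subst_stoup t u) (subst_stoup t' u').
Proof.
  intros Ht Hu.
  eapply eec_trans; [apply eec_sym, eec_llam_beta|].
  eapply eec_trans; [|apply eec_llam_beta].
  apply eec_lapp; [apply eec_llam|]; assumption.
Qed.

End Substitution.

(** * Fullness *)

Section Fullness.

Context {L V C : Type} (incl : L -> V) (R : cty V C).
Notation world := (list (sty L)).
Notation "⟦ H ⟧" := (lvctx incl R H).
Implicit Types (H : world) (G : ctx V C).

(* A morphism of worlds is a renaming of lambda-contexts together with the
   induced renaming of their translations. *)
Record wmor H H' := Wmor {
  wren : ren H H';
  lvren : ren ⟦H⟧ ⟦H'⟧;
  lvren_lvvar : forall b (v : var H b),
    lvren _ (lvvar incl R v) = lvvar incl R (wren _ v)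
}.

Arguments wren {H H'}.
Arguments lvren {H H'}.
Arguments lvren_lvvar {H H'}.

Definition wid H : wmor H H.
Proof. exists (fun _ v => v) (fun _ v => v); reflexivity. Defined.

Definition wcomp {H H' H''} (e : wmor H H') (e' : wmor H' H'') : wmor H H''.
Proof.
  exists (fun _ v => wren e' _ (wren e _ v))
    (fun _ v => lvren e' _ (lvren e _ v)).
  intros b v; rewrite !lvren_lvvar; reflexivity.
Defined.

Definition wdrop {H} b : wmor H (b :: H).
Proof. exists (fun _ v => vs v) (fun _ v => vs v); reflexivity. Defined.

Definition wkeep {H H'} b (e : wmor H H') : wmor (b :: H) (b :: H').
Proof.
  exists (up_ren (wren e)) (up_ren (lvren e)).
  intros c v; dependent destruction v; cbn; [reflexivity|].
  rewrite lvren_lvvar; reflexivity.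
Defined.

Definition move {H H' D A} (t : term ⟦H⟧ D A) (e : wmor H H') :
    term ⟦H'⟧ D A :=
  rename t (lvren e).

Lemma move_id {H D A} (t : term ⟦H⟧ D A) : move t (wid H) = t.
Proof. apply rename_id. Qed.

Lemma move_move {H H' H'' D A} (t : term ⟦H⟧ D A) (e : wmor H H')
    (e' : wmor H' H'') : move (move t e) e' = move t (wcomp e e').
Proof. unfold move; rewrite rename_rename; reflexivity. Qed.

Lemma move_subst_stoup {H H' D A E} (t : term ⟦H⟧ (Some E) A)
    (u : term ⟦H⟧ D (vcomp E)) (e : wmor H H') :
  move (subst_stoup t u) e = subst_stoup (move t e) (move u e).
Proof. apply rename_subst_stoup. Qed.

Lemma eec_eq_move {H H' D A} (t u : term ⟦H⟧ D A) (e : wmor H H') :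
  eec_eq t u -> eec_eq (move t e) (move u e).
Proof. intros E; apply eec_eq_rename, E. Qed.

Lemma lvtm_rename {H a} (M : tm H a) : forall H' (r : ren H H')
    (r' : ren ⟦H⟧ ⟦H'⟧),
  (forall b (v : var H b), r' _ (lvvar incl R v) = lvvar incl R (r _ v)) ->
  lvtm incl R (mrename M r) = rename (lvtm incl R M) r'.
Proof.
  induction M; intros H' r r' Hr; cbn [lvtm mrename rename];
    repeat match goal with
    | IH : forall _, _ |- _ => erewrite IH by eassumption
    end; rewrite ?Hr, ?weaken_rename; try reflexivity.
  do 3 f_equal; apply IHM.
  intros c v; dependent destruction v; cbn; [reflexivity|].
  rewrite <- Hr; reflexivity.
Qed.

Lemma lvtm_move {H H' a} (M : tm H a) (e : wmor H H') :
  lvtm incl R (mrename M (wren e)) = move (lvtm incl R M) e.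
Proof. apply lvtm_rename, lvren_lvvar. Qed.

Lemma weaken_move {H D A} (t : term ⟦H⟧ D A) b :
  weaken (lvty incl R b) t = move t (wdrop b).
Proof. reflexivity. Qed.

(** * Observations and the logical predicates *)

Definition bind {H D b} (M : tm H b) (s : term ⟦b :: H⟧ D (vcomp R)) :
    term ⟦H⟧ D (vcomp R) :=
  tlapp (lvtm incl R M) (tclam s).

Lemma bind_subst_stoup {H D E b} (M : tm H b)
    (s : term ⟦b :: H⟧ (Some E) (vcomp R)) (u : term ⟦H⟧ D (vcomp E)) :
  subst_stoup (bind M s) u = bind M (subst_stoup s (weaken (lvty incl R b) u)).
Proof.
  unfold bind, subst_stoup; cbn [subst ssub_weaken].
  rewrite up_vsub_id, subst_none_id; reflexivity.
Qed.

Lemma bind_congr {H D b} (M : tm H b) (s s' : term ⟦b :: H⟧ D (vcomp R)) :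
  eec_eq s s' -> eec_eq (bind M s) (bind M s').
Proof.
  intros E; apply eec_lapp; [apply eec_refl|apply eec_clam, E].
Qed.

Lemma move_bind {H H' D b} (M : tm H b) (s : term ⟦b :: H⟧ D (vcomp R))
    (e : wmor H H') :
  move (bind M s) e = bind (mrename M (wren e)) (move s (wkeep b e)).
Proof. unfold bind; rewrite lvtm_move; reflexivity. Qed.

(* Observations [z : D |- s : R] are closed under the effects of the
   lambda-calculus by running a computation before them. *)
Inductive closure {D : cty V C}
    (gen : forall H, term ⟦H⟧ (Some D) (vcomp R) -> Prop) :
    forall H, term ⟦H⟧ (Some D) (vcomp R) -> Prop :=
| closure_gen H s : gen H s -> closure gen H s
| closure_bind H b (M : tm H b) s : closure gen (b :: H) s ->
    closure gen H (bind M s)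
| closure_eq H s s' : closure gen H s -> eec_eq s s' -> closure gen H s'.

(** Having [D] as an index lets [cpred] use this at every constant and at [cI] without deciding
    equality with [R]: it is empty unless [D] is [R]. *)
Inductive is_stoup_var :
    forall D H, term ⟦H⟧ (Some D) (vcomp R) -> Prop :=
| is_stoup_var_intro H : is_stoup_var R H tsvar.

Definition eta {G A} (t : term G None A) : term G None (lcont R A) :=
  tllam (tcapp tsvar t).

(** The type is an index for the same reason: a value-type constant outside the image of [incl] gets
    the empty predicate. *)
Inductive def_const {H} : forall A, term ⟦H⟧ None A -> Prop :=
| def_const_intro c (M : tm H (sconst c)) t :
    eec_eq (lvtm incl R M) (eta t) -> def_const (vconst (incl c)) t.

(** The empty stoup is seen as the stoup [cI] with [ttop] plugged in. When [R] is a constant there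
    is no generator, and no closed answer satisfies this. *)
Definition answer_pred H (r : term ⟦H⟧ None (vcomp R)) : Prop :=
  exists s, closure (is_stoup_var cI) H s /\ eec_eq r (subst_stoup s ttop).

Fixpoint vpred (A : vty V C) : forall H, term ⟦H⟧ None A -> Prop :=
  match A with
  | vconst v => fun H t => def_const (vconst v) t
  | vone => fun H t => True
  | vprod A B => fun H t => vpred A H (tfst t) /\ vpred B H (tsnd t)
  | varr A B => fun H t => forall H' (e : wmor H H') a,
      vpred A H' a -> vpred B H' (tapp (move t e) a)
  | vcomp A => fun H t => forall H' (e : wmor H H') s,
      cpred A H' s -> answer_pred H' (subst_stoup s (move t e))
  | vlolli A B => fun H t => forall H' (e : wmor H H') s,
      cpred B H' s -> cpred A H' (subst_stoup s (tlapp (move t e) tsvar))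
  end
with cpred (A : cty V C) : forall H, term ⟦H⟧ (Some A) (vcomp R) -> Prop :=
  match A with
  | cconst c => closure (is_stoup_var (cconst c))
  | cone => fun H s => False
  | cwith A B => closure (fun H s =>
      (exists s', cpred A H s' /\ s = subst_stoup s' (tcfst tsvar)) \/
      (exists s', cpred B H s' /\ s = subst_stoup s' (tcsnd tsvar)))
  | cpow A B => closure (fun H s => exists a s',
      vpred A H a /\ cpred B H s' /\ s = subst_stoup s' (tcapp tsvar a))
  | cI => closure (is_stoup_var cI)
  | cbang A => fun H s => forall H' (e : wmor H H') a,
      vpred A H' a -> answer_pred H' (subst_stoup (move s e) (tbang a))
  | ctens A B => fun H s => forall H' (e : wmor H H') a,
      vpred A H' a -> cpred B H' (subst_stoup (move s e) (ttens a tsvar))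
  | czero => fun H s => True
  | cplus A B => fun H s =>
      cpred A H (subst_stoup s (tinl tsvar)) /\
      cpred B H (subst_stoup s (tinr tsvar))
  end.

Scheme vty_mind := Induction for vty Sort Prop
with cty_mind := Induction for cty Sort Prop.
Combined Scheme types_ind from vty_mind, cty_mind.

Lemma answer_pred_eq H r r' : answer_pred H r -> eec_eq r r' -> answer_pred H r'.
Proof.
  intros (s & Hs & E) E'; exists s; split; [assumption|].
  eauto using eec_trans, eec_sym.
Qed.

Lemma answer_pred_bind H b (M : tm H b) r :
  answer_pred (b :: H) r -> answer_pred H (bind M r).
Proof.
  intros (s & Hs & E); exists (bind M s); split; [apply closure_bind, Hs|].
  rewrite bind_subst_stoup; apply bind_congr, E.
Qed.

Lemma pred_eq :
  (forall A H t t', vpred A H t -> eec_eq t t' -> vpred A H t') /\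
  (forall A H s s', cpred A H s -> eec_eq s s' -> cpred A H s').
Proof.
  apply types_ind; cbn [vpred cpred]; try (intros; eapply closure_eq; eassumption);
    try (intros; exact I); try (intros; contradiction).
  - intros v H t t' Ht E; destruct Ht as [c M t E'].
    apply def_const_intro with (M := M); eapply eec_trans; [exact E'|].
    apply eec_llam, eec_capp; [apply eec_refl|exact E].
  - intros A IHA B IHB H t t' [Ha Hb] E; split.
    + eapply IHA; [exact Ha|apply eec_fst, E].
    + eapply IHB; [exact Hb|apply eec_snd, E].
  - intros A IHA B IHB H t t' Ht E H' e a Ha.
    eapply IHB; [apply Ht, Ha|].
    apply eec_app; [apply eec_eq_move, E|apply eec_refl].
  - intros A IHA H t t' Ht E H' e s Hs.
    eapply answer_pred_eq; [apply Ht, Hs|].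
    apply eec_eq_subst_stoup; [apply eec_refl|apply eec_eq_move, E].
  - intros A IHA B IHB H t t' Ht E H' e s Hs.
    eapply IHA; [apply Ht, Hs|].
    apply eec_eq_subst_stoup; [apply eec_refl|].
    apply eec_lapp; [apply eec_eq_move, E|apply eec_refl].
  - intros A IHA H s s' Hs E H' e a Ha.
    eapply answer_pred_eq; [apply Hs, Ha|].
    apply eec_eq_subst_stoup; [apply eec_eq_move, E|apply eec_refl].
  - intros A IHA B IHB H s s' Hs E H' e a Ha.
    eapply IHB; [apply Hs, Ha|].
    apply eec_eq_subst_stoup; [apply eec_eq_move, E|apply eec_refl].
  - intros A IHA B IHB H s s' [Ha Hb] E; split.
    + eapply IHA; [exact Ha|]; apply eec_eq_subst_stoup; auto using eec_refl.
    + eapply IHB; [exact Hb|]; apply eec_eq_subst_stoup; auto using eec_refl.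
Qed.

Definition vpred_eq A H t t' : vpred A H t -> eec_eq t t' -> vpred A H t' :=
  proj1 pred_eq A H t t'.
Definition cpred_eq A H s s' : cpred A H s -> eec_eq s s' -> cpred A H s' :=
  proj2 pred_eq A H s s'.

Lemma closure_move {D} (gen : forall H, term ⟦H⟧ (Some D) (vcomp R) -> Prop) :
  (forall H H' (e : wmor H H') s, gen H s -> gen H' (move s e)) ->
  forall H H' (e : wmor H H') s, closure gen H s -> closure gen H' (move s e).
Proof.
  intros Hgen H H' e s Hs; revert H' e.
  induction Hs as [H s Hs|H b M s Hs IH|H s s' Hs IH E]; intros H' e.
  - apply closure_gen, Hgen, Hs.
  - rewrite move_bind; apply closure_bind, IH.
  - eapply closure_eq; [apply IH|apply eec_eq_move, E].
Qed.

Lemma is_stoup_var_move D H H' (e : wmor H H') s :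
  is_stoup_var D H s -> is_stoup_var D H' (move s e).
Proof. intros Hs; revert H' e; destruct Hs; constructor. Qed.

Lemma pred_move :
  (forall A H H' (e : wmor H H') t, vpred A H t -> vpred A H' (move t e)) /\
  (forall A H H' (e : wmor H H') s, cpred A H s -> cpred A H' (move s e)).
Proof.
  apply types_ind; cbn [vpred cpred]; try (intros; exact I);
    try (intros; contradiction);
    try (intros; apply closure_move; [apply is_stoup_var_move|assumption]).
  - intros v H H' e t Ht; destruct Ht as [c M t E].
    apply def_const_intro with (M := mrename M (wren e)).
    rewrite lvtm_move; exact (eec_eq_move _ _ e E).
  - intros A IHA B IHB H H' e t [Ha Hb]; split.
    + exact (IHA _ _ e _ Ha).
    + exact (IHB _ _ e _ Hb).
  - intros A IHA B IHB H H' e t Ht H'' e' a Ha.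
    rewrite move_move; apply Ht, Ha.
  - intros A IHA H H' e t Ht H'' e' s Hs.
    rewrite move_move; apply Ht, Hs.
  - intros A IHA B IHB H H' e t Ht H'' e' s Hs.
    rewrite move_move; apply Ht, Hs.
  - intros A IHA B IHB H H' e s; apply closure_move; clear H H' e s.
    intros H H' e s [(s' & Hs' & ->)|(s' & Hs' & ->)];
      rewrite move_subst_stoup; [left|right]; eauto.
  - intros A IHA B IHB H H' e s; apply closure_move; clear H H' e s.
    intros H H' e s (a & s' & Ha & Hs' & ->).
    exists (move a e), (move s' e); rewrite move_subst_stoup; auto.
  - intros A IHA H H' e s Hs H'' e' a Ha.
    rewrite move_move; apply Hs, Ha.
  - intros A IHA B IHB H H' e s Hs H'' e' a Ha.
    rewrite move_move; apply Hs, Ha.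
  - intros A IHA B IHB H H' e s [Ha Hb]; split.
    + apply (IHA _ _ e) in Ha; rewrite move_subst_stoup in Ha; exact Ha.
    + apply (IHB _ _ e) in Hb; rewrite move_subst_stoup in Hb; exact Hb.
Qed.

Definition vpred_move A H H' (e : wmor H H') t :
    vpred A H t -> vpred A H' (move t e) :=
  proj1 pred_move A H H' e t.
Definition cpred_move A H H' (e : wmor H H') s :
    cpred A H s -> cpred A H' (move s e) :=
  proj2 pred_move A H H' e s.

(** Closure under [bind] is built in for the generated types; for the types defined by elimination
    it descends to the components, because [bind] commutes with plugging in a term. *)
Lemma cpred_bind A : forall H b (M : tm H b) s,
  cpred A (b :: H) s -> cpred A H (bind M s).
Proof.
  induction A; cbn [cpred]; intros H b M s Hs; try (apply closure_bind, Hs);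
    try (exact Hs).
  - intros H' e a Ha; rewrite move_bind, bind_subst_stoup.
    apply answer_pred_bind, Hs, (vpred_move _ _ _ (wdrop b)), Ha.
  - intros H' e a Ha; rewrite move_bind, bind_subst_stoup.
    apply IHA, (Hs _ (wkeep b e)), (vpred_move _ _ _ (wdrop b)), Ha.
  - rewrite !bind_subst_stoup; destruct Hs; split; auto.
Qed.

(* What an observation becomes once a term with stoup [D] is plugged in. *)
Definition stoup_pred (D : stoup V C) H : term ⟦H⟧ D (vcomp R) -> Prop :=
  match D with
  | None => answer_pred H
  | Some A => cpred A H
  end.

Lemma stoup_pred_eq D H r r' :
  stoup_pred D H r -> eec_eq r r' -> stoup_pred D H r'.
Proof. destruct D; [apply cpred_eq|apply answer_pred_eq]. Qed.

Lemma stoup_pred_bind D H b (M : tm H b) r :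
  stoup_pred D (b :: H) r -> stoup_pred D H (bind M r).
Proof. destruct D; [apply cpred_bind|apply answer_pred_bind]. Qed.

(** With a nonempty stoup only computation types occur, hence [True] elsewhere. At computation types
    later worlds are left out, so that both kinds of stoup are treated alike; [vpred_subst] brings
    them back. *)
Definition term_pred D (A : vty V C) H : term ⟦H⟧ D A -> Prop :=
  match A with
  | vcomp B => fun t => forall s, cpred B H s -> stoup_pred D H (subst_stoup s t)
  | A => match D with
         | None => vpred A H
         | Some _ => fun _ => True
         end
  end.

Lemma vpred_term_pred A H t : vpred A H t -> term_pred None A H t.
Proof.
  destruct A; try exact (fun p => p).
  intros Ht s Hs; rewrite <- (move_id t); apply Ht, Hs.
Qed.

Lemma term_pred_vpred A H t :
  (forall H' (e : wmor H H'), term_pred None A H' (move t e)) -> vpred A H t.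
Proof.
  intros Ht; destruct A;
    try (specialize (Ht H (wid H)); rewrite move_id in Ht; exact Ht).
  exact Ht.
Qed.

(** * Environments and the fundamental lemma *)

Definition penv G H (g : vsub G ⟦H⟧) : Prop := forall A v, vpred A H (g A v).

Definition vsub_move {G H H'} (g : vsub G ⟦H⟧) (e : wmor H H') : vsub G ⟦H'⟧ :=
  fun A v => move (g A v) e.

Lemma penv_move G H H' (e : wmor H H') g :
  penv G H g -> penv G H' (vsub_move g e).
Proof. intros Hg A v; apply vpred_move, Hg. Qed.

Lemma penv_cons G A H (a : term ⟦H⟧ None A) g :
  vpred A H a -> penv G H g -> penv (A :: G) H (vsub_cons a g).
Proof.
  intros Ha Hg B v; dependent destruction v; [exact Ha|apply Hg].
Qed.

Lemma move_subst {G D A H H'} (t : term G D A) (g : vsub G ⟦H⟧)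
    (e : wmor H H') :
  move (subst t _ _ g (ssub_id D)) e = subst t _ _ (vsub_move g e) (ssub_id D).
Proof. unfold move; rewrite rename_subst, ssub_rename_id; reflexivity. Qed.

Lemma move_subst_none {G A H H'} (t : term G None A) (g : vsub G ⟦H⟧)
    (e : wmor H H') :
  move (subst t _ _ g ss_none) e = subst t _ _ (vsub_move g e) ss_none.
Proof. exact (move_subst t g e). Qed.

Lemma subst1_subst {G G' D A B} (t : term (B :: G) D A) (g : vsub G G')
    (a : term G' None B) :
  subst1 (subst t _ _ (up_vsub g) (ssub_id D)) a =
  subst t _ _ (vsub_cons a g) (ssub_id D).
Proof.
  unfold subst1; rewrite subst_subst; unfold up_vsub; rewrite vsub_cons_subst.
  f_equal; [cbn; f_equal|destruct D; reflexivity].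
  extensionality E; extensionality v; rewrite subst_weaken; apply subst_none_id.
Qed.

(** Here and in the next lemmas an eliminator is applied to the stoup variable, giving the composite
    observations to which induction hypotheses are applied in [fundamental]. *)
Lemma subst_stoup_capp {G D A B} (a : term G None A)
    (u : term G D (vcomp (cpow A B))) :
  subst_stoup (tcapp tsvar a) u = tcapp u a.
Proof. unfold subst_stoup; cbn; rewrite subst_none_id; reflexivity. Qed.

Lemma subst_stoup_lettop {G D A} (a : term G None (vcomp A))
    (u : term G D (vcomp cI)) :
  subst_stoup (tlettop tsvar a) u = tlettop u a.
Proof. unfold subst_stoup; cbn; rewrite subst_none_id; reflexivity. Qed.

Lemma subst_stoup_letbang {G D A B} (a : term (A :: G) None (vcomp B))
    (u : term G D (vcomp (cbang A))) :
  subst_stoup (tletbang tsvar a) u = tletbang u a.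
Proof.
  unfold subst_stoup; cbn; rewrite up_vsub_id, subst_none_id; reflexivity.
Qed.

Lemma subst_stoup_tens {G D A B} (a : term G None A) (u : term G D (vcomp B)) :
  subst_stoup (ttens a tsvar) u = ttens a u.
Proof. unfold subst_stoup; cbn; rewrite subst_none_id; reflexivity. Qed.

Lemma subst_stoup_lettens {G D A B E} (a : term (A :: G) (Some B) (vcomp E))
    (u : term G D (vcomp (ctens A B))) :
  subst_stoup (tlettens tsvar a) u = tlettens u a.
Proof.
  rewrite <- (subst_stoup_id a) at 2; unfold subst_stoup; cbn.
  rewrite up_vsub_id; reflexivity.
Qed.

Lemma subst_stoup_case {G D A B E} (a : term G (Some A) (vcomp E))
    (b : term G (Some B) (vcomp E)) (u : term G D (vcomp (cplus A B))) :
  subst_stoup (tcase tsvar a b) u = tcase u a b.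
Proof.
  rewrite <- (subst_stoup_id a) at 2; rewrite <- (subst_stoup_id b) at 2.
  reflexivity.
Qed.

Lemma subst_stoup_lapp {G D A B} (a : term G None (vlolli A B))
    (u : term G D (vcomp A)) :
  subst_stoup (tlapp a tsvar) u = tlapp a u.
Proof. unfold subst_stoup; cbn; rewrite subst_none_id; reflexivity. Qed.

(** Only generators need checking: plugging in a term commutes with [bind] once the environment is
    moved under the new variable. Hence the quantification over all worlds and environments. *)
Lemma closure_elim {G D A}
    (gen : forall H, term ⟦H⟧ (Some A) (vcomp R) -> Prop)
    (t : term G D (vcomp A)) :
  (forall H g s, penv G H g -> gen H s ->
    stoup_pred D H (subst_stoup s (subst t _ _ g (ssub_id D)))) ->
  forall H g s, penv G H g -> closure gen H s ->
    stoup_pred D H (subst_stoup s (subst t _ _ g (ssub_id D))).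
Proof.
  intros Hgen H g s Hg Hs; revert g Hg.
  induction Hs as [H s Hs|H b M s Hs IH|H s s' Hs IH E]; intros g Hg.
  - auto.
  - rewrite bind_subst_stoup, weaken_move, move_subst.
    apply stoup_pred_bind, IH, penv_move, Hg.
  - eapply stoup_pred_eq; [apply IH, Hg|].
    apply eec_eq_subst_stoup; [exact E|apply eec_refl].
Qed.

(** Since the hypothesis ranges over all worlds, moving the environment supplies the later worlds
    that [term_pred] omits. *)
Lemma vpred_subst {G A} (t : term G None A) :
  (forall H g, penv G H g -> term_pred None A H (subst t _ _ g ss_none)) ->
  forall H g, penv G H g -> vpred A H (subst t _ _ g ss_none).
Proof.
  intros Ht H g Hg; apply term_pred_vpred; intros H' e.
  rewrite move_subst_none; apply Ht, penv_move, Hg.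
Qed.

(** For an eliminator, the given observation is composed with the eliminator on the stoup variable,
    and the hypothesis for the principal premise is applied to the composite. Introductions of [&]
    and [=>] go through [closure_elim] and beta. *)
Lemma fundamental {G D A} (t : term G D A) : forall H g, penv G H g ->
  term_pred D A H (subst t _ _ g (ssub_id D)).
Proof.
  induction t; intros H g Hg; cbn [ssub_id] in *.
  - apply vpred_term_pred, Hg.
  - exact I.
  - cbn; split; eapply vpred_eq.
    + apply (vpred_subst _ IHt1), Hg.
    + apply eec_sym, eec_fst_beta.
    + apply (vpred_subst _ IHt2), Hg.
    + apply eec_sym, eec_snd_beta.
  - apply vpred_term_pred, (IHt H g Hg).
  - apply vpred_term_pred, (IHt H g Hg).
  - intros H' e a Ha.
    rewrite move_subst_none; eapply vpred_eq.
    + exact (vpred_subst _ IHt _ _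
        (penv_cons _ _ _ a _ Ha (penv_move _ _ _ e _ Hg))).
    + pose proof (subst1_subst t (vsub_move g e) a) as E.
      cbn [ssub_id] in E; rewrite <- E.
      apply eec_sym, eec_lam_beta.
  - apply vpred_term_pred.
    pose proof (IHt1 H g Hg H (wid H) _ (vpred_subst _ IHt2 H g Hg)) as E.
    rewrite move_id in E; exact E.
  - intros s Hs; cbn; rewrite subst_stoup_id; exact Hs.
  - intros s [].
  - intros s Hs; revert H g s Hg Hs; apply closure_elim.
    intros H g s Hg [(s' & Hs' & ->)|(s' & Hs' & ->)];
      rewrite subst_stoup_stoup; cbn [subst].
    + eapply stoup_pred_eq; [apply (IHt1 H g Hg), Hs'|].
      apply eec_eq_subst_stoup; [apply eec_refl|apply eec_sym, eec_cfst_beta].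
    + eapply stoup_pred_eq; [apply (IHt2 H g Hg), Hs'|].
      apply eec_eq_subst_stoup; [apply eec_refl|apply eec_sym, eec_csnd_beta].
  - intros s Hs; pose proof (IHt H g Hg (subst_stoup s (tcfst tsvar))) as E.
    rewrite subst_stoup_stoup in E; apply E, closure_gen; eauto.
  - intros s Hs; pose proof (IHt H g Hg (subst_stoup s (tcsnd tsvar))) as E.
    rewrite subst_stoup_stoup in E; apply E, closure_gen; eauto.
  - intros s Hs; revert H g s Hg Hs; apply closure_elim.
    intros H g s Hg (a & s' & Ha & Hs' & ->); rewrite subst_stoup_stoup.
    cbn [subst]; rewrite ssub_weaken_id; eapply stoup_pred_eq.
    + exact (IHt H _ (penv_cons _ _ _ a _ Ha Hg) _ Hs').
    + apply eec_eq_subst_stoup; [apply eec_refl|].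
      rewrite <- subst1_subst, subst_stoup_capp; apply eec_sym, eec_clam_beta.
  - intros s Hs.
    pose proof (IHt1 H g Hg
      (subst_stoup s (tcapp tsvar (subst t2 _ _ g ss_none)))) as E.
    rewrite subst_stoup_stoup, subst_stoup_capp in E.
    apply E, closure_gen; do 2 eexists; repeat split; [|exact Hs].
    apply (vpred_subst _ IHt2), Hg.
  - intros s Hs; exists s; split; [exact Hs|apply eec_refl].
  (* The body yields an answer [s0[top]] with [s0] an observation of [cI]; this [s0] is the
     observation to use on the scrutinee. *)
  - intros s Hs; destruct (IHt2 H g Hg s Hs) as (s0 & Hs0 & E).
    eapply stoup_pred_eq; [apply (IHt1 H g Hg), Hs0|].
    eapply eec_trans; [apply eec_sym, eec_top_eta|].
    eapply eec_trans; [apply eec_lettop; [apply eec_refl|apply eec_sym, E]|].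
    (* Eta at this instance is the commuting conversion that pulls the [let] out of [s]. *)
    pose proof (eec_top_eta (subst t1 _ _ g (ssub_id D))
      (subst_stoup s (tlettop tsvar (subst t2 _ _ g ss_none)))) as E'.
    rewrite !subst_stoup_stoup, !subst_stoup_lettop in E'.
    eapply eec_trans; [|exact E'].
    apply eec_lettop; [apply eec_refl|].
    apply eec_eq_subst_stoup; [apply eec_refl|apply eec_sym, eec_top_beta].
  - intros s Hs; pose proof (Hs H (wid H) _ (vpred_subst _ IHt H g Hg)) as E.
    rewrite move_id in E; exact E.
  - intros s Hs.
    pose proof (IHt1 H g Hg (subst_stoup s
      (tletbang tsvar (subst t2 _ _ (up_vsub g) ss_none)))) as E.
    rewrite subst_stoup_stoup, subst_stoup_letbang in E.
    apply E; intros H' e a Ha.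
    rewrite move_subst_stoup, subst_stoup_stoup; eapply answer_pred_eq.
    + exact (IHt2 H' _ (penv_cons _ _ _ a _ Ha (penv_move _ _ _ e _ Hg)) _
        (cpred_move _ _ _ e _ Hs)).
    + apply eec_eq_subst_stoup; [apply eec_refl|].
      pose proof (subst1_subst t2 (vsub_move g e) a) as E2.
      cbn [ssub_id] in E2; rewrite <- E2.
      eapply eec_trans; [apply eec_sym, eec_bang_beta|].
      unfold move; cbn [rename].
      rewrite subst_stoup_letbang, rename_subst, <- up_vsub_rename; apply eec_refl.
  - intros s Hs.
    pose proof (IHt2 H g Hg (subst_stoup s
      (ttens (subst t1 _ _ g ss_none) tsvar))) as E.
    rewrite subst_stoup_stoup, subst_stoup_tens in E; apply E.
    rewrite <- (move_id s); apply (Hs H (wid H)), (vpred_subst _ IHt1), Hg.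
  - intros s Hs.
    pose proof (IHt1 H g Hg (subst_stoup s
      (tlettens tsvar (subst t2 _ _ (up_vsub g) (ss_some tsvar))))) as E'.
    rewrite subst_stoup_stoup, subst_stoup_lettens in E'.
    apply E'; intros H' e a Ha.
    rewrite move_subst_stoup, subst_stoup_stoup; eapply cpred_eq.
    + exact (IHt2 H' _ (penv_cons _ _ _ a _ Ha (penv_move _ _ _ e _ Hg)) _
        (cpred_move _ _ _ e _ Hs)).
    + apply eec_eq_subst_stoup; [apply eec_refl|].
      pose proof (subst1_subst t2 (vsub_move g e) a) as E2.
      cbn [ssub_id] in E2; rewrite <- E2.
      eapply eec_trans; [apply eec_sym, (eec_tens_beta a tsvar)|].
      unfold move; cbn [rename].
      rewrite subst_stoup_lettens, rename_subst, <- up_vsub_rename; apply eec_refl.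
  - intros s Hs; pose proof (IHt H g Hg (subst_stoup s (tabort tsvar)) I) as E.
    rewrite subst_stoup_stoup in E; exact E.
  - intros s [Hs _]; pose proof (IHt H g Hg _ Hs) as E.
    rewrite subst_stoup_stoup in E; exact E.
  - intros s [_ Hs]; pose proof (IHt H g Hg _ Hs) as E.
    rewrite subst_stoup_stoup in E; exact E.
  - intros s Hs.
    pose proof (IHt1 H g Hg (subst_stoup s (tcase tsvar
      (subst t2 _ _ g (ss_some tsvar)) (subst t3 _ _ g (ss_some tsvar))))) as E'.
    rewrite subst_stoup_stoup, subst_stoup_case in E'.
    apply E'; split; rewrite subst_stoup_stoup, subst_stoup_case; eapply cpred_eq.
    + exact (IHt2 H g Hg _ Hs).
    + apply eec_eq_subst_stoup; [apply eec_refl|].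
      eapply eec_trans; [|apply eec_sym, eec_inl_beta].
      rewrite subst_stoup_id; apply eec_refl.
    + exact (IHt3 H g Hg _ Hs).
    + apply eec_eq_subst_stoup; [apply eec_refl|].
      eapply eec_trans; [|apply eec_sym, eec_inr_beta].
      rewrite subst_stoup_id; apply eec_refl.
  - intros H' e s Hs.
    eapply cpred_eq; [apply (IHt H' _ (penv_move _ _ _ e _ Hg)), Hs|].
    apply eec_eq_subst_stoup; [apply eec_refl|].
    pose proof (move_subst t g e) as E; cbn [ssub_id] in E; rewrite <- E.
    eapply eec_trans; [|apply eec_sym, eec_llam_beta].
    rewrite subst_stoup_id; apply eec_refl.
  - intros s Hs; pose proof (IHt1 H g Hg H (wid H) s Hs) as E.
    rewrite move_id in E; apply (IHt2 H g Hg) in E.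
    rewrite subst_stoup_stoup, subst_stoup_lapp in E; exact E.
Qed.

(** * Definability at translated types *)

Lemma run_eta {G D A} (m : term G None (lcont R A)) (t : term G None A)
    (b : term (A :: G) D (vcomp R)) :
  eec_eq m (eta t) -> eec_eq (tlapp m (tclam b)) (subst1 b t).
Proof.
  intros E; eapply eec_trans; [apply eec_lapp; [exact E|apply eec_refl]|].
  eapply eec_trans; [apply eec_llam_beta|].
  rewrite subst_stoup_capp; apply eec_clam_beta.
Qed.

Lemma tapp_weaken_tlam {G A B} (t : term (A :: G) None B) :
  eec_eq (tapp (weaken A (tlam t)) (tvar vz)) t.
Proof.
  eapply eec_trans; [apply eec_lam_beta|].
  unfold subst1; rewrite subst_rename, vsub_cons_up_ren; cbn [ssub_id].
  replace (vsub_cons (tvar vz) (fun E v => vsub_id E (vs v))) with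
    (@vsub_id _ _ (A :: G)).
  - rewrite subst_none_id; apply eec_refl.
  - extensionality E; extensionality v; dependent destruction v; reflexivity.
Qed.

Lemma lvtm_mapp_eta {H a b} (M : tm H (sarr a b)) (N : tm H a) t
    (m : term ⟦H⟧ None (lcont R (lvty incl R a))) :
  eec_eq (lvtm incl R M) (eta t) -> eec_eq (lvtm incl R N) m ->
  eec_eq (lvtm incl R (mapp M N))
    (tllam (tlapp m
      (tclam (tlapp (tapp (weaken (lvty incl R a) t) (tvar vz)) tsvar)))).
Proof.
  intros Et Em; apply eec_llam.
  eapply eec_trans; [apply run_eta, Et|].
  unfold subst1; cbn [subst]; rewrite subst_weaken, subst_none_id.
  apply eec_lapp; [exact Em|apply eec_refl].
Qed.

Lemma lvtm_mapp_def {H a b} (M : tm H (sarr a b)) (N : tm H a) t u :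
  eec_eq (lvtm incl R M) (eta t) -> eec_eq (lvtm incl R N) (eta u) ->
  eec_eq (lvtm incl R (mapp M N)) (tapp t u).
Proof.
  intros Et Eu; eapply eec_trans; [apply lvtm_mapp_eta; eassumption|].
  eapply eec_trans; [apply eec_llam, run_eta, eec_refl|].
  unfold subst1; cbn [subst ssub_none ssub_term ssub_id vsub_cons].
  rewrite subst_weaken, subst_none_id; apply eec_llam_eta.
Qed.

(** This is how a [bind] produced by the closure is absorbed into a lambda-term. *)
Lemma lvtm_mlet {H a b} (M : tm H a) (N : tm (a :: H) b) :
  eec_eq (lvtm incl R (mlet M N))
    (tllam (bind M (tlapp (lvtm incl R N) tsvar))).
Proof.
  eapply eec_trans; [apply lvtm_mapp_eta; apply eec_refl|].
  apply eec_llam, eec_lapp; [apply eec_refl|].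
  apply eec_clam, eec_lapp; [apply tapp_weaken_tlam|apply eec_refl].
Qed.

Lemma lvtm_mpair_def {H a b} (M : tm H a) (N : tm H b) t u :
  eec_eq (lvtm incl R M) (eta t) -> eec_eq (lvtm incl R N) (eta u) ->
  eec_eq (lvtm incl R (mpair M N)) (eta (tpair t u)).
Proof.
  intros Et Eu; apply eec_llam.
  eapply eec_trans; [apply run_eta, Et|].
  unfold subst1; cbn [subst]; rewrite subst_weaken, subst_none_id.
  eapply eec_trans; [apply run_eta, Eu|].
  apply eec_capp; [apply eec_refl|apply eec_pair; [|apply eec_refl]].
  change (eec_eq (subst1 (weaken (lvty incl R b) t) u) t).
  rewrite subst1_weaken; apply eec_refl.
Qed.

Definition definable a H (t : term ⟦H⟧ None (lvty incl R a)) : Prop :=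
  exists M : tm H a, eec_eq (lvtm incl R M) (eta t).

Context (incl_inj : forall a b : L, incl a = incl b -> a = b).
(** The shape of [R] enters fullness only here; for a constant and for [cI] the two sides agree by
    computation. *)
Context (cpred_R : forall H s, cpred R H s <-> closure (is_stoup_var R) H s).

Lemma def_const_inv {H} c (t : term ⟦H⟧ None (vconst (incl c))) :
  def_const (vconst (incl c)) t -> definable (sconst c) H t.
Proof.
  intros Ht.
  (* The index is not a variable, so it is generalised with a transport, which [eq_rect_eq] removes
     without decidable equality of constants. *)
  assert (Hgen : forall A u, @def_const H A u ->
    forall E : A = vconst (incl c),
    definable (sconst c) H (eq_rect A (term ⟦H⟧ None) u _ E)).
  { intros A u [c' M u' Eu] E; injection E as Ec.
    apply incl_inj in Ec; subst c'; rewrite <- eq_rect_eq; exists M; exact Eu. }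
  exact (Hgen _ _ Ht eq_refl).
Qed.

Lemma is_stoup_var_inv H (s : term ⟦H⟧ (Some R) (vcomp R)) :
  is_stoup_var R H s -> s = tsvar.
Proof.
  intros Hs.
  assert (Hgen : forall D s, is_stoup_var D H s -> forall E : D = R,
    eq_rect D (fun D => term ⟦H⟧ (Some D) (vcomp R)) s R E = tsvar).
  { intros D s' Hs' E; destruct Hs'; rewrite <- eq_rect_eq; reflexivity. }
  exact (Hgen _ _ Hs eq_refl).
Qed.

Lemma tlapp_mlet {H a b} (N : tm H a) (M : tm (a :: H) b) s :
  eec_eq (tlapp (lvtm incl R M) tsvar) s ->
  eec_eq (tlapp (lvtm incl R (mlet N M)) tsvar) (bind N s).
Proof.
  intros E; eapply eec_trans.
  { apply eec_lapp; [apply lvtm_mlet|apply eec_refl]. }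
  eapply eec_trans; [apply eec_llam_beta|].
  rewrite subst_stoup_id; apply bind_congr, E.
Qed.

Section Computations.

(** Working relative to a single [a] allows the induction on types in [vpred_definable] to use these
    results at the codomain of an arrow. *)
Context (a : sty L)
  (vpred_definable : forall H t, vpred (lvty incl R a) H t <-> definable a H t).

(** An observation of [R] is a sequence of computations ending in [z], up to equality; with [z @ t]
    in place of [z] it becomes nested lets around a term defining [t]. *)
Lemma subst_stoup_definable H s : closure (is_stoup_var R) H s -> forall t,
  vpred (lvty incl R a) H t -> exists M : tm H a,
    eec_eq (tlapp (lvtm incl R M) tsvar) (subst_stoup s (tcapp tsvar t)).
Proof.
  induction 1 as [H s Hs|H b N s Hs IH|H s s' Hs IH E]; intros t Ht.
  - apply is_stoup_var_inv in Hs as ->.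
    apply vpred_definable in Ht as [M E]; exists M.
    eapply eec_trans; [apply eec_lapp; [exact E|apply eec_refl]|].
    eapply eec_trans; [apply eec_llam_beta|].
    rewrite subst_stoup_id; apply eec_refl.
  - destruct (IH (weaken _ t)) as [M E]; [apply (vpred_move _ _ _ (wdrop b)), Ht|].
    exists (mlet N M); rewrite bind_subst_stoup; apply tlapp_mlet, E.
  - destruct (IH t Ht) as [M E']; exists M; eapply eec_trans; [exact E'|].
    apply eec_eq_subst_stoup; [exact E|apply eec_refl].
Qed.

Lemma cpred_cpow_definable H s : cpred (cpow (lvty incl R a) R) H s ->
  exists M : tm H a, eec_eq (tlapp (lvtm incl R M) tsvar) s.
Proof.
  induction 1 as [H s (t & s' & Ht & Hs & ->)|H b N s Hs [M E]|H s s' Hs [M E] E'].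
  - apply subst_stoup_definable; [apply cpred_R, Hs|exact Ht].
  - exists (mlet N M); apply tlapp_mlet, E.
  - exists M; eapply eec_trans; eassumption.
Qed.

Lemma subst_stoup_lvtm H s : closure (is_stoup_var R) H s -> forall M : tm H a,
  cpred (cpow (lvty incl R a) R) H (subst_stoup s (tlapp (lvtm incl R M) tsvar)).
Proof.
  induction 1 as [H s Hs|H b N s Hs IH|H s s' Hs IH E]; intros M.
  - apply is_stoup_var_inv in Hs as ->.
    (* Eta-expanding the continuation [z] exhibits [M] run before the generator [z @ x], with [x] a
       variable of the larger world. *)
    apply (closure_eq _ _ (bind M (tcapp tsvar (tvar vz)))).
    + apply closure_bind, closure_gen; exists (tvar vz), tsvar; split; [|split].
      * apply vpred_definable; exists (mvar vz); apply eec_refl.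
      * apply cpred_R, closure_gen; constructor.
      * reflexivity.
    + apply eec_lapp; [apply eec_refl|apply (eec_clam_eta tsvar)].
  - rewrite bind_subst_stoup; apply closure_bind.
    pose proof (IH (mrename M (wren (wdrop b)))) as E.
    rewrite lvtm_move in E; exact E.
  - eapply closure_eq; [apply (IH M)|].
    apply eec_eq_subst_stoup; [exact E|apply eec_refl].
Qed.

(** Testing [t] on the observation [z] of [R] identifies [t{z}] with some [M^lv{z}], and eta for
    [tllam] removes [z]. *)
Lemma vpred_lcont H t : vpred (lcont R (lvty incl R a)) H t <->
  exists M : tm H a, eec_eq (lvtm incl R M) t.
Proof.
  split.
  - intros Ht.
    assert (Hz : cpred R H tsvar) by (apply cpred_R, closure_gen; constructor).
    apply (Ht H (wid H)) in Hz; rewrite move_id in Hz.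
    apply cpred_cpow_definable in Hz as [M E]; exists M.
    eapply eec_trans; [apply eec_sym, eec_llam_eta|].
    eapply eec_trans; [|apply eec_llam_eta].
    apply eec_llam, E.
  - intros [M E]; eapply vpred_eq; [|exact E].
    intros H' e s Hs; apply cpred_R in Hs.
    pose proof (subst_stoup_lvtm H' s Hs (mrename M (wren e))) as E'.
    rewrite lvtm_move in E'; exact E'.
Qed.

End Computations.

Lemma vpred_definable a :
  forall H t, vpred (lvty incl R a) H t <-> definable a H t.
Proof.
  induction a as [c| |a IHa b IHb|a IHa b IHb]; intros H t.
  - split; [apply def_const_inv|intros [M E]; exact (def_const_intro c M t E)].
  - split; [intros _|exact (fun _ => I)].
    exists mstar; apply eec_llam, eec_capp; [apply eec_refl|].
    apply eec_sym, eec_one_eta.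
  - split.
    + intros [Ha Hb]; apply IHa in Ha as [M EM]; apply IHb in Hb as [N EN].
      exists (mpair M N); eapply eec_trans; [apply lvtm_mpair_def; eassumption|].
      apply eec_llam, eec_capp; [apply eec_refl|apply eec_pair_eta].
    + intros [M E]; split; [apply IHa; exists (mfst M)|apply IHb; exists (msnd M)];
        apply eec_llam; (eapply eec_trans; [apply run_eta, E|apply eec_refl]).
  - split.
    + intros Ht.
      (* A function is tested on a fresh variable in the extended world; the term defining the
         result is then abstracted. *)
      assert (Hv : vpred (lvty incl R a) (a :: H) (tvar vz)).
      { apply IHa; exists (mvar vz); apply eec_refl. }
      apply (Ht _ (wdrop a)) in Hv; apply (vpred_lcont b IHb) in Hv as [M E].
      exists (mlam M); apply eec_llam, eec_capp; [apply eec_refl|].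
      eapply eec_trans; [apply eec_lam, E|apply eec_lam_eta].
    + intros [M E] H' e u Hu; apply IHa in Hu as [N EN].
      apply (vpred_lcont b IHb); exists (mapp (mrename M (wren e)) N).
      apply lvtm_mapp_def; [|exact EN].
      rewrite lvtm_move; exact (eec_eq_move _ _ e E).
Qed.

Theorem lvtm_full H a (t : term ⟦H⟧ None (lcont R (lvty incl R a))) :
  exists M : tm H a, eec_eq (lvtm incl R M) t.
Proof.
  apply (vpred_lcont a (vpred_definable a)).
  rewrite <- (subst_none_id t); apply vpred_subst; [exact (fundamental t)|].
  (* That the type of a variable of [⟦H⟧] is a translated type is visible only after inspecting
     [H]. *)
  clear a t; induction H as [|a H IH]; intros A v; [inversion v|].
  cbn in v; dependent destruction v.
  - apply vpred_definable; exists (mvar vz); apply eec_refl.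
  - exact (vpred_move _ _ _ (wdrop a) _ (IH _ v)).
Qed.

End Fullness.

(** * Substitution in the lambda-calculus *)

Section LambdaSyntax.

Context {L : Type}.
Implicit Types (H : list (sty L)).

Lemma mrename_id {H a} (M : tm H a) : mrename M (fun _ v => v) = M.
Proof. induction M; cbn [mrename]; rewrite ?up_ren_id; congruence. Qed.

Lemma mrename_mrename {H a} (M : tm H a) : forall H' H''
    (r : ren H H') (r' : ren H' H''),
  mrename (mrename M r) r' = mrename M (fun _ v => r' _ (r _ v)).
Proof.
  induction M; intros H' H'' r r'; cbn [mrename]; rewrite_hyps;
    rewrite ?up_ren_comp; reflexivity.
Qed.

Lemma msub_cons_up_ren {H H' H'' b} (N : tm H'' b) (r : ren H H')
    (s : msub H' H'') :
  (fun a v => msub_cons N s a (up_ren r a v)) =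
  msub_cons N (fun a v => s a (r a v)).
Proof.
  extensionality a; extensionality v; dependent destruction v; reflexivity.
Qed.

Lemma msubst_mrename {H a} (M : tm H a) : forall H' H'' (r : ren H H')
    (s : msub H' H''),
  msubst (mrename M r) s = msubst M (fun _ v => s _ (r _ v)).
Proof.
  induction M; intros H' H'' r s; cbn [mrename msubst]; rewrite_hyps;
    unfold up_msub; rewrite ?msub_cons_up_ren; reflexivity.
Qed.

Lemma msub_cons_mrename {H H' H'' b} (N : tm H' b) (s : msub H H')
    (r : ren H' H'') :
  (fun a v => mrename (msub_cons N s a v) r) =
  msub_cons (mrename N r) (fun a v => mrename (s a v) r).
Proof.
  extensionality a; extensionality v; dependent destruction v; reflexivity.
Qed.

Lemma mweaken_mrename {H H' a b} (M : tm H a) (r : ren H H') :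
  mweaken b (mrename M r) = mrename (mweaken b M) (up_ren r).
Proof. unfold mweaken; rewrite !mrename_mrename; reflexivity. Qed.

Lemma up_msub_mrename {H H' H'' b} (s : msub H H') (r : ren H' H'') :
  (fun a v => mrename (up_msub (b := b) s a v) (up_ren r)) =
  up_msub (fun a v => mrename (s a v) r).
Proof.
  unfold up_msub; rewrite msub_cons_mrename; cbn [mrename up_ren]; f_equal.
  extensionality a; extensionality v; symmetry; apply mweaken_mrename.
Qed.

Lemma mrename_msubst {H a} (M : tm H a) : forall H' H'' (s : msub H H')
    (r : ren H' H''),
  mrename (msubst M s) r = msubst M (fun _ v => mrename (s _ v) r).
Proof.
  induction M; intros H' H'' s r; cbn [mrename msubst]; rewrite_hyps;
    rewrite ?up_msub_mrename; reflexivity.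
Qed.

Lemma msub_cons_msubst {H H' H'' b} (N : tm H' b) (s : msub H H')
    (s' : msub H' H'') :
  (fun a v => msubst (msub_cons N s a v) s') =
  msub_cons (msubst N s') (fun a v => msubst (s a v) s').
Proof.
  extensionality a; extensionality v; dependent destruction v; reflexivity.
Qed.

Lemma msubst_mweaken {H H' a b} (M : tm H a) (N : tm H' b) (s : msub H H') :
  msubst (mweaken b M) (msub_cons N s) = msubst M s.
Proof. apply msubst_mrename. Qed.

Lemma up_msub_msubst {H H' H'' b} (s : msub H H') (s' : msub H' H'') :
  (fun a v => msubst (up_msub (b := b) s a v) (up_msub s')) =
  up_msub (fun a v => msubst (s a v) s').
Proof.
  unfold up_msub at 1; rewrite msub_cons_msubst.
  unfold up_msub at 3; cbn [msubst]; f_equal.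
  extensionality a; extensionality v; unfold up_msub.
  rewrite msubst_mweaken; unfold mweaken; rewrite mrename_msubst; reflexivity.
Qed.

Lemma msubst_msubst {H a} (M : tm H a) : forall H' H'' (s : msub H H')
    (s' : msub H' H''),
  msubst (msubst M s) s' = msubst M (fun _ v => msubst (s _ v) s').
Proof.
  induction M; intros H' H'' s s'; cbn [msubst]; rewrite_hyps;
    rewrite ?up_msub_msubst; reflexivity.
Qed.

Lemma up_msub_id {H b} :
  up_msub (b := b) (fun a (v : var H a) => mvar v) = (fun _ v => mvar v).
Proof.
  extensionality a; extensionality v; dependent destruction v; reflexivity.
Qed.

Lemma msubst_id {H a} (M : tm H a) : msubst M (fun _ v => mvar v) = M.
Proof. induction M; cbn [msubst]; rewrite ?up_msub_id; congruence. Qed.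

Lemma mrename_msubst1 {H H' a b} (M : tm (b :: H) a) (N : tm H b)
    (r : ren H H') :
  mrename (msubst1 M N) r = msubst1 (mrename M (up_ren r)) (mrename N r).
Proof.
  unfold msubst1; rewrite mrename_msubst, msubst_mrename.
  rewrite msub_cons_mrename, msub_cons_up_ren; reflexivity.
Qed.

Lemma is_value_mrename {H H' a} (M : tm H a) (r : ren H H') :
  is_value M -> is_value (mrename M r).
Proof. induction 1; cbn [mrename]; constructor; assumption. Qed.

Lemma lc_eq_mrename {H a} (M N : tm H a) : lc_eq M N ->
  forall H' (r : ren H H'), lc_eq (mrename M r) (mrename N r).
Proof.
  induction 1; intros H' r; unfold mlet in *; cbn [mrename] in *;
    rewrite ?mrename_msubst1, <- ?mweaken_mrename; cbn [up_ren];
    try (econstructor; eauto using is_value_mrename; fail).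
  (* What remains is [lc_let_assoc], where the weakening of [P] must be commuted with the
     renaming. *)
  rewrite mrename_mrename, up_ren_comp.
  eapply lc_trans; [apply lc_let_assoc|].
  rewrite mrename_mrename, up_ren_comp; apply lc_refl.
Qed.

Lemma mlet_congr {H a b} (M M' : tm H a) (N N' : tm (a :: H) b) :
  lc_eq M M' -> lc_eq N N' -> lc_eq (mlet M N) (mlet M' N').
Proof. intros EM EN; apply lc_app; [apply lc_lam|]; assumption. Qed.

End LambdaSyntax.

(** * A model of EEC in sets *)

Section SetModel.

(* Every type constant, and the unit [cI], denotes the same set [X].  Linear
   maps are interpreted by all functions, and a value of computation type [A]
   by a linear map from [cI] to [A]. *)
Context {V C : Type} (X : Type).

Fixpoint vden (A : vty V C) : Type :=
  match A with
  | vconst _ => X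
  | vone => unit
  | vprod A B => vden A * vden B
  | varr A B => vden A -> vden B
  | vcomp A => X -> cden A
  | vlolli A B => cden A -> cden B
  end
with cden (A : cty V C) : Type :=
  match A with
  | cconst _ => X
  | cone => unit
  | cwith A B => cden A * cden B
  | cpow A B => vden A -> cden B
  | cI => X
  | cbang A => vden A * X
  | ctens A B => vden A * cden B
  | czero => Empty_set
  | cplus A B => cden A + cden B
  end.

Definition sden (D : stoup V C) : Type :=
  match D with
  | None => X
  | Some A => cden A
  end.

(** No term has a nonempty stoup and a type other than a computation type, hence [Empty_set]. At
    computation types an empty stoup behaves as the stoup [cI]. *)
Definition jden (D : stoup V C) (A : vty V C) : Type :=
  match A with
  | vcomp B => sden D -> cden B
  | A => match D with
         | None => vden A
         | Some _ => Empty_set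
         end
  end.

(** An identity in every case; it is needed because the two types agree by computation only once the
    head of [A] is known. *)
Definition to_v {A} : jden None A -> vden A :=
  match A with
  | vcomp _ => fun x => x
  | _ => fun x => x
  end.

Definition of_v {A} : vden A -> jden None A :=
  match A with
  | vcomp _ => fun x => x
  | _ => fun x => x
  end.

Lemma to_v_of_v A (x : vden A) : to_v (of_v x) = x.
Proof. destruct A; reflexivity. Qed.

Lemma of_v_to_v A (x : jden None A) : of_v (to_v x) = x.
Proof. destruct A; reflexivity. Qed.

Definition env (G : ctx V C) : Type := forall A, var G A -> vden A.

Definition env_cons {G A} (a : vden A) (g : env G) : env (A :: G) :=
  fun B v =>
    match v in var G0 B0
      return match G0 with
             | [] => unit
             | A0 :: G1 => vden A0 -> env G1 -> vden B0
             end
    with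
    | vz => fun a' _ => a'
    | vs v' => fun _ g' => g' _ v'
    end a g.

Fixpoint den {G D A} (t : term G D A) {struct t} : env G -> jden D A :=
  match t in term _ D0 A0 return env G -> jden D0 A0 with
  | tvar v => fun g => of_v (g _ v)
  | tstar => fun g => tt
  | tpair t u => fun g => (to_v (den t g), to_v (den u g))
  | tfst t => fun g => of_v (fst (den t g))
  | tsnd t => fun g => of_v (snd (den t g))
  | tlam t => fun g a => to_v (den t (env_cons a g))
  | tapp t u => fun g => of_v (den t g (to_v (den u g)))
  | tsvar => fun g w => w
  | tcstar => fun g w => tt
  | tcpair t u => fun g w => (den t g w, den u g w)
  | tcfst t => fun g w => fst (den t g w)
  | tcsnd t => fun g w => snd (den t g w)
  | tclam t => fun g w a => den t (env_cons a g) w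
  | tcapp s t => fun g w => den s g w (to_v (den t g))
  | ttop => fun g w => w
  | tlettop t u => fun g w => den u g (den t g w)
  | tbang t => fun g w => (to_v (den t g), w)
  | tletbang t u => fun g w =>
      den u (env_cons (fst (den t g w)) g) (snd (den t g w))
  | ttens t u => fun g w => (to_v (den t g), den u g w)
  | tlettens s t => fun g w =>
      den t (env_cons (fst (den s g w)) g) (snd (den s g w))
  | tabort t => fun g w => match den t g w return _ with end
  | tinl t => fun g w => inl (den t g w)
  | tinr t => fun g w => inr (den t g w)
  | tcase s t u => fun g w =>
      match den s g w with
      | inl a => den t g a
      | inr b => den u g b
      end
  | tllam t => fun g => den t g
  | tlapp s t => fun g w => den s g (den t g w)
  end.

(** * Substitution and soundness in the set model *)

Lemma env_cons_up_ren {G G' A} (r : ren G G') (g : env G') (a : vden A) :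
  (fun B v => env_cons a g B (up_ren r B v)) =
  env_cons a (fun B v => g B (r B v)).
Proof.
  extensionality B; extensionality v; dependent destruction v; reflexivity.
Qed.

Lemma den_rename {G D A} (t : term G D A) : forall G' (r : ren G G') g,
  den (rename t r) g = den t (fun B v => g B (r B v)).
Proof.
  induction t; intros G' r g; cbn [rename den]; rewrite_hyps;
    try reflexivity.
  - extensionality a; rewrite IHt, env_cons_up_ren; reflexivity.
  - extensionality w; extensionality a; rewrite IHt, env_cons_up_ren; reflexivity.
  - extensionality w; rewrite IHt2, env_cons_up_ren; reflexivity.
  - extensionality w; rewrite IHt2, env_cons_up_ren; reflexivity.
Qed.

Definition ssden {G D D'} (d : ssub G D D') : env G -> sden D' -> sden D :=
  match d in ssub _ D0 D1 return env G -> sden D1 -> sden D0 with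
  | ss_none => fun g w => w
  | ss_some t => den t
  end.

(** Reindexing along [f]. The substitution [d] serves to know that an empty stoup stays empty, so
    that elements of value types can be kept. *)
Definition jmap {G D D'} (d : ssub G D D') (A : vty V C) (f : sden D' -> sden D) :
    jden D A -> jden D' A :=
  match d in ssub _ D0 D1
    return (sden D1 -> sden D0) -> jden D0 A -> jden D1 A
  with
  | ss_none =>
      match A return (sden None -> sden None) -> jden None A -> jden None A with
      | vcomp B => fun f x w => x (f w)
      | _ => fun f x => x
      end
  | @ss_some _ _ _ E D1 t =>
      match A return (sden D1 -> sden (Some E)) -> jden (Some E) A -> jden D1 A
      with
      | vcomp B => fun f x w => x (f w)
      | _ => fun f x => match x with end
      end
  end f.

Lemma jmap_vcomp {G D D'} (d : ssub G D D') B f (x : jden D (vcomp B)) :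
  jmap d (vcomp B) f x = fun w => x (f w).
Proof. destruct d; reflexivity. Qed.

Lemma jmap_none {G A} f (x : jden None A) :
  (forall w, f w = w) -> jmap (@ss_none _ _ G) A f x = x.
Proof.
  intros Hf; destruct A; try reflexivity.
  cbn; extensionality w; rewrite Hf; reflexivity.
Qed.

Definition senv {G G'} (s : vsub G G') (g : env G') : env G :=
  fun A v => to_v (den (s A v) g).

Lemma den_weaken {G D A B} (t : term G D A) (b : vden B) g :
  den (weaken B t) (env_cons b g) = den t g.
Proof. unfold weaken; rewrite den_rename; reflexivity. Qed.

Lemma senv_cons {G G' B} (u : term G' None B) (s : vsub G G') g :
  senv (vsub_cons u s) g = env_cons (to_v (den u g)) (senv s g).
Proof.
  extensionality A; extensionality v; dependent destruction v; reflexivity.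
Qed.

Lemma senv_up {G G' B} (s : vsub G G') (b : vden B) g :
  senv (up_vsub s) (env_cons b g) = env_cons b (senv s g).
Proof.
  unfold up_vsub; rewrite senv_cons; cbn [den env_cons]; rewrite to_v_of_v.
  f_equal; extensionality A; extensionality v; unfold senv.
  rewrite den_weaken; reflexivity.
Qed.

Lemma ssden_weaken {G D D' B} (d : ssub G D D') (b : vden B) g :
  ssden (ssub_weaken B d) (env_cons b g) = ssden d g.
Proof. destruct d; cbn; [reflexivity|exact (den_weaken t b g)]. Qed.

Lemma den_subst {G D A} (t : term G D A) : forall G' D' (s : vsub G G')
    (d : ssub G' D D') g,
  den (subst t _ _ s d) g = jmap d A (ssden d g) (den t (senv s g)).
Proof.
  induction t; intros G' D' s d g; rewrite ?jmap_vcomp; cbn [subst];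
    try (dependent destruction d; [idtac]);
    cbn [ssub_none ssub_term den ssden].
  all: try (rewrite (jmap_none (G := G')) by reflexivity).
  all: repeat match goal with
    | |- (fun _ => _) = _ => extensionality w
    end.
  all: rewrite_hyps; rewrite ?jmap_vcomp; cbn [ssden].
  all: repeat (rewrite (jmap_none (G := G')) by reflexivity).
  all: rewrite ?senv_up, ?ssden_weaken; try reflexivity.
  - symmetry; apply of_v_to_v.
  - rewrite jmap_none; reflexivity.
  - extensionality a; rewrite IHt, jmap_vcomp, senv_up, ssden_weaken.
    reflexivity.
Qed.

Lemma senv_id G (g : env G) : senv vsub_id g = g.
Proof.
  extensionality A; extensionality v; unfold senv; cbn; apply to_v_of_v.
Qed.

Lemma den_subst_stoup {G D A B} (t : term G (Some A) (vcomp B))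
    (u : term G D (vcomp A)) g :
  den (subst_stoup t u) g = fun w => den t g (den u g w).
Proof.
  unfold subst_stoup; rewrite den_subst, jmap_vcomp, senv_id; reflexivity.
Qed.

Lemma jmap_id {G D A} (g : env G) (x : jden D A) :
  jmap (@ssub_id _ _ G D) A (ssden (ssub_id D) g) x = x.
Proof. destruct D, A; try destruct x; reflexivity. Qed.

Lemma den_subst1 {G D A B} (t : term (B :: G) D A) (u : term G None B) g :
  den (subst1 t u) g = den t (env_cons (to_v (den u g)) g).
Proof.
  unfold subst1; rewrite den_subst, senv_cons, senv_id.
  apply jmap_id.
Qed.

Lemma den_subst2 {G D A B E} (t : term (B :: G) (Some E) (vcomp A))
    (u : term G None B) (w : term G D (vcomp E)) g :
  den (subst2 t u w) g =
  fun x => den t (env_cons (to_v (den u g)) g) (den w g x).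
Proof.
  unfold subst2; rewrite den_subst, jmap_vcomp, senv_cons, senv_id; reflexivity.
Qed.

(** With the stoup variable read as an ordinary argument, the eta laws of [cbang], [ctens], [cplus]
    and [czero] are case splits on that argument. *)
Theorem eec_eq_sound {G D A} (t u : term G D A) :
  eec_eq t u -> forall g, den t g = den u g.
Proof.
  induction 1; intros g; cbn [den];
    rewrite ?den_subst1, ?den_subst_stoup, ?den_subst2; rewrite_hyps;
    cbn [den]; try reflexivity.
  - extensionality a; rewrite_hyps; reflexivity.
  - extensionality w; extensionality a; rewrite_hyps; reflexivity.
  - extensionality w; rewrite_hyps; reflexivity.
  - extensionality w; rewrite_hyps; reflexivity.
  - destruct (den t g); reflexivity.
  - apply of_v_to_v.
  - apply of_v_to_v.
  - rewrite !to_v_of_v; destruct (den t g); reflexivity.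
  - apply of_v_to_v.
  - extensionality a; rewrite !to_v_of_v, den_weaken; reflexivity.
  - extensionality w; destruct (den t g w); reflexivity.
  - extensionality w; destruct (den t g w); reflexivity.
  - extensionality w; extensionality a.
    rewrite to_v_of_v, den_weaken; reflexivity.
  - extensionality w; rewrite den_subst_stoup, den_weaken; cbn [den env_cons].
    rewrite to_v_of_v; destruct (den t g w); reflexivity.
  - extensionality w; rewrite den_subst_stoup, den_weaken; cbn [den env_cons].
    rewrite to_v_of_v; destruct (den t g w); reflexivity.
  - extensionality w; destruct (den t g w).
  - extensionality w; destruct (den t g w); reflexivity.
Qed.

End SetModel.

(** * Faithfulness *)

(** Arbitrary renamings would not do here: a fresh variable needs one definite name in each later
    context, which [ext_unique] guarantees. *)
Inductive ext {T : Type} (H : list T) : list T -> Type :=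
| ext_refl : ext H H
| ext_cons {H'} (b : T) : ext H H' -> ext H (b :: H').

Arguments ext_refl {T H}.
Arguments ext_cons {T H H'}.

Fixpoint ext_trans {T : Type} {H H' H'' : list T} (e : ext H H')
    (e' : ext H' H'') : ext H H'' :=
  match e' with
  | ext_refl => e
  | ext_cons b e' => ext_cons b (ext_trans e e')
  end.

Fixpoint shift {T : Type} {H H' : list T} (e : ext H H') : ren H H' :=
  match e in ext _ H0 return ren H H0 with
  | ext_refl => fun _ v => v
  | ext_cons b e => fun _ v => vs (shift e _ v)
  end.

Lemma shift_trans {T : Type} {H H' H'' : list T} (e : ext H H')
    (e' : ext H' H'') A v :
  shift (ext_trans e e') A v = shift e' A (shift e A v).
Proof. induction e'; cbn; [reflexivity|]; rewrite IHe'; reflexivity. Qed.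

Lemma ext_length {T : Type} {H H' : list T} :
  ext H H' -> length H <= length H'.
Proof. induction 1; cbn; lia. Qed.

(** By length no context extends itself properly, so the two constructors never compete. *)
Lemma ext_unique {T : Type} {H H' : list T} (e e' : ext H H') : e = e'.
Proof.
  induction e as [|H' b e IH].
  - dependent destruction e'; [reflexivity|].
    exfalso; apply ext_length in e'; cbn in e'; lia.
  - dependent destruction e'; [|f_equal; apply IH].
    exfalso; clear IH; apply ext_length in e; cbn in e; lia.
Qed.

Section Faithfulness.

Context {L V C : Type} (incl : L -> V) (R : cty V C).
Implicit Types (H : list (sty L)) (a b c : sty L).

(** * Normalisation by evaluation: reification and reflection *)

Definition cls a : Type := forall H, tm H a -> Prop.
(** The type is an argument as well, since one set of answers must serve continuations with results
    of every type. Constants denote this set too, whence [retype] in [reflect]. *)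
Definition fam : Type := forall H a, tm H a -> Prop.

(* The two cases of the theorem both give [cden fam R = fam]; they are treated
   together by means of a retraction. *)
Context (to_fam : cden (V := V) (C := C) fam R -> fam)
  (of_fam : fam -> cden fam R)
  (to_of_fam : forall f, to_fam (of_fam f) = f).

Notation "⟦ a ⟧" := (vden fam (lvty incl R a)).
Notation answer := (cden fam R).

Definition retype {a} (F : cls a) : fam :=
  fun H b N => exists E : b = a, F H (eq_rect b (tm H) N a E).

Lemma retype_self {a} (F : cls a) H N : retype F H a N <-> F H N.
Proof.
  split.
  - intros [E HF]; rewrite <- eq_rect_eq in HF; exact HF.
  - intros HF; exists eq_refl; exact HF.
Qed.

(** The variable bound on top of [H], under its name in each later context; the class is empty in
    contexts that do not extend [a :: H]. *)
Definition var_cls a H : cls a :=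
  fun H' N => exists e : ext (a :: H) H', lc_eq (mvar (shift e _ vz)) N.

(** Applying an unknown function is an effect, so [reflect] at an arrow captures the continuation
    [k] and inserts a let that names the result, with [k] at the fresh name as body. In [reify] the
    final continuation reads back the value. *)
Fixpoint reify a : ⟦a⟧ -> cls a :=
  match a return ⟦a⟧ -> cls a with
  | sconst c => fun d H N => d H (sconst c) N
  | sone => fun _ H N => lc_eq mstar N
  | sprod a b => fun d H N => exists P Q,
      reify a (fst d) H P /\ reify b (snd d) H Q /\ lc_eq (mpair P Q) N
  | sarr a b => fun d H N => exists B,
      to_fam (d (reflect a (var_cls a H))
        (fun v => of_fam (retype (reify b v)))) (a :: H) b B /\
      lc_eq (mlam B) N
  end
with reflect a : cls a -> ⟦a⟧ :=
  match a return cls a -> ⟦a⟧ with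
  | sconst c => fun F => retype F
  | sone => fun _ => tt
  | sprod a b => fun F =>
      (reflect a (fun H N => exists P, F H P /\ lc_eq (mfst P) N),
       reflect b (fun H N => exists P, F H P /\ lc_eq (msnd P) N))
  | sarr a b => fun F d k => of_fam (fun H c N => exists P Q B,
      F H P /\ reify a d H Q /\
      to_fam (k (reflect b (var_cls b H))) (b :: H) c B /\
      lc_eq (mlet (mapp P Q) B) N)
  end.

(** * The relation between denotations and terms *)

Definition mshift {H H' a} (M : tm H a) (e : ext H H') : tm H' a :=
  mrename M (shift e).

Lemma mshift_refl {H a} (M : tm H a) : mshift M ext_refl = M.
Proof. apply mrename_id. Qed.

Lemma mshift_mshift {H H' H'' a} (M : tm H a) (e : ext H H') (e' : ext H' H'') :
  mshift (mshift M e) e' = mshift M (ext_trans e e').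
Proof.
  unfold mshift; rewrite mrename_mrename; f_equal.
  extensionality b; extensionality v; rewrite shift_trans; reflexivity.
Qed.

Definition inst {H H' a b} (K : tm (a :: H) b) (e : ext H H') (W : tm H' a) :
    tm H' b :=
  msubst K (msub_cons W (fun _ v => mvar (shift e _ v))).

(** An equivalence: in every later context [F] is exactly the [lc_eq]-class of [M]. Equal
    denotations therefore force equal terms. *)
Definition cls_rel {H a} (F : cls a) (M : tm H a) : Prop :=
  forall H' (e : ext H H') N, F H' N <-> lc_eq (mshift M e) N.

Definition fam_rel {H a} (f : fam) (M : tm H a) : Prop :=
  cls_rel (fun H' => f H' a) M.

(* Computations are related by their behaviour under related continuations, a
   continuation being a term to be run in a [let]. *)
Definition run_rel {a} (rel : forall H, ⟦a⟧ -> tm H a -> Prop) {H}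
    (x : (⟦a⟧ -> answer) -> answer) (M : tm H a) : Prop :=
  forall c (k : ⟦a⟧ -> answer) (K : tm (a :: H) c),
    (forall H' (e : ext H H') v W, is_value W -> rel H' v W ->
      fam_rel (to_fam (k v)) (inst K e W)) ->
    fam_rel (to_fam (x k)) (mlet M K).

Definition comp_rel {a} (rel : forall H, ⟦a⟧ -> tm H a -> Prop) {H}
    (x : (⟦a⟧ -> answer) -> answer) (M : tm H a) : Prop :=
  forall H' (e : ext H H'), run_rel rel x (mshift M e).

(** Being a value is demanded separately; projections of values are values, so the demand passes to
    components of products. *)
Fixpoint val_rel a : forall H, ⟦a⟧ -> tm H a -> Prop :=
  match a return forall H, ⟦a⟧ -> tm H a -> Prop with
  | sconst c => fun H d W => fam_rel d W
  | sone => fun H d W => True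
  | sprod a b => fun H d W =>
      val_rel a H (fst d) (mfst W) /\ val_rel b H (snd d) (msnd W)
  | sarr a b => fun H d W => forall H' (e : ext H H') d' W',
      is_value W' -> val_rel a H' d' W' ->
      comp_rel (val_rel b) (d d') (mapp (mshift W e) W')
  end.

Lemma cls_rel_eq {H a} (F : cls a) (M M' : tm H a) :
  lc_eq M M' -> cls_rel F M -> cls_rel F M'.
Proof.
  intros E HM H' e N; apply (lc_eq_mrename _ _) with (r := shift e) in E.
  split; intros HN.
  - apply (HM H' e) in HN; eapply lc_trans; [apply lc_sym, E|exact HN].
  - apply (HM H' e); eapply lc_trans; [exact E|exact HN].
Qed.

Lemma cls_rel_shift {H H' a} (F : cls a) (M : tm H a) (e : ext H H') :
  cls_rel F M -> cls_rel F (mshift M e).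
Proof. intros HM H'' e' N; rewrite mshift_mshift; apply HM. Qed.

Lemma comp_rel_eq {a} (rel : forall H, ⟦a⟧ -> tm H a -> Prop) {H} x
    (M M' : tm H a) :
  lc_eq M M' -> comp_rel rel x M -> comp_rel rel x M'.
Proof.
  intros E HM H' e c k K HK; eapply cls_rel_eq; [|apply HM, HK].
  apply mlet_congr; [apply lc_eq_mrename, E|apply lc_refl].
Qed.

Lemma comp_rel_run {a} (rel : forall H, ⟦a⟧ -> tm H a -> Prop) {H} x (M : tm H a) :
  comp_rel rel x M -> run_rel rel x M.
Proof. intros HM; rewrite <- (mshift_refl M); apply HM. Qed.

Lemma val_rel_eq a : forall H d (W W' : tm H a),
  lc_eq W W' -> val_rel a H d W -> val_rel a H d W'.
Proof.
  induction a as [c| |a IHa b IHb|a IHa b IHb]; intros H d W W' E; cbn.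
  - apply cls_rel_eq, E.
  - trivial.
  - intros [Ha Hb]; split; [eapply IHa|eapply IHb]; eauto using lc_fst, lc_snd.
  - intros HW H' e d' U HU Hd'; eapply comp_rel_eq; [|apply HW; eassumption].
    apply lc_app; [apply lc_eq_mrename, E|apply lc_refl].
Qed.

Lemma val_rel_shift a : forall H H' (e : ext H H') d (W : tm H a),
  val_rel a H d W -> val_rel a H' d (mshift W e).
Proof.
  induction a as [c| |a IHa b IHb|a IHa b IHb]; intros H H' e d W; cbn.
  - apply cls_rel_shift.
  - trivial.
  - intros [Ha Hb]; split; [exact (IHa _ _ e _ _ Ha)|exact (IHb _ _ e _ _ Hb)].
  - intros HW H'' e' d' U HU Hd'; rewrite mshift_mshift; auto.
Qed.

Lemma var_cls_rel a H : cls_rel (H := a :: H) (var_cls a H) (mvar vz).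
Proof.
  intros H' e N; split.
  - intros [e' E]; rewrite (ext_unique e e'); exact E.
  - intros E; exists e; exact E.
Qed.

Lemma cls_rel_map {H a b} (F : cls a) (M : tm H a)
    (op : forall H, tm H a -> tm H b) :
  (forall H P P', lc_eq P P' -> lc_eq (op H P) (op H P')) ->
  (forall H' (e : ext H H'), mshift (op H M) e = op H' (mshift M e)) ->
  cls_rel F M ->
  cls_rel (fun H N => exists P, F H P /\ lc_eq (op H P) N) (op H M).
Proof.
  intros Hop Hs HM H' e N; rewrite Hs; split.
  - intros (P & HP & E); apply (HM H' e) in HP.
    eapply lc_trans; [apply Hop, HP|exact E].
  - intros E; exists (mshift M e); split; [apply (HM H' e), lc_refl|exact E].
Qed.

Lemma inst_vz {H H' a} (e : ext H H') (W : tm H' a) : inst (mvar vz) e W = W.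
Proof. reflexivity. Qed.

Lemma inst_var {H a b} (K : tm (a :: H) b) :
  inst K (ext_cons a ext_refl) (mvar vz) = K.
Proof.
  unfold inst; rewrite <- (msubst_id K) at 2; f_equal.
  extensionality c; extensionality v; dependent destruction v; reflexivity.
Qed.

Lemma inst_mshift {H H' H'' a b} (K : tm (a :: H) b) (e : ext H H')
    (e' : ext H' H'') (W : tm H'' a) :
  inst (mrename K (up_ren (shift e))) e' W = inst K (ext_trans e e') W.
Proof.
  unfold inst; rewrite msubst_mrename, msub_cons_up_ren; f_equal; f_equal.
  extensionality c; extensionality v; rewrite shift_trans; reflexivity.
Qed.

(** At an arrow, reflection needs reification of the argument, and reification needs reflection of a
    fresh one, so both are proved together. Reification at non-constant types rests on the eta laws
    for values. *)
Lemma reflect_reify_rel a :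
  (forall H F (W : tm H a), is_value W -> cls_rel F W ->
    val_rel a H (reflect a F) W) /\
  (forall H d (W : tm H a), is_value W -> val_rel a H d W ->
    cls_rel (reify a d) W).
Proof.
  induction a as [c| |a [IHa IHa'] b [IHb IHb']|a [IHa IHa'] b [IHb IHb']].
  - split.
    + intros H F W _ HF H' e N; rewrite <- (HF H' e N); apply retype_self.
    + intros H d W _ Hd; exact Hd.
  - split; [exact (fun _ _ _ _ _ => I)|].
    intros H d W HW _ H' e N; cbn.
    pose proof (lc_one_eta _ (is_value_mrename W (shift e) HW)) as E.
    split; intros EN; eauto using lc_trans, lc_sym.
  - split.
    + intros H F W HW HF; split.
      * apply IHa; [constructor; exact HW|].
        apply (cls_rel_map F W (fun H => mfst)); auto using lc_fst.
      * apply IHb; [constructor; exact HW|].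
        apply (cls_rel_map F W (fun H => msnd)); auto using lc_snd.
    + intros H d W HW [Ha Hb] H' e N; cbn [reify].
      apply IHa' in Ha; [|constructor; exact HW].
      apply IHb' in Hb; [|constructor; exact HW].
      pose proof (lc_pair_eta _ (is_value_mrename W (shift e) HW)) as E.
      split.
      * intros (P & Q & HP & HQ & EN).
        apply (Ha H' e) in HP; apply (Hb H' e) in HQ.
        eapply lc_trans; [apply lc_sym, E|].
        eapply lc_trans; [apply lc_pair; [exact HP|exact HQ]|exact EN].
      * intros EN; exists (mfst (mshift W e)), (msnd (mshift W e)).
        split; [apply (Ha H' e), lc_refl|split; [apply (Hb H' e), lc_refl|]].
        eapply lc_trans; [exact E|exact EN].
  - assert (Hvar : forall H, val_rel a (a :: H) (reflect a (var_cls a H)) (mvar vz)).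
    { intros H; apply IHa; [constructor|apply var_cls_rel]. }
    assert (Hvar' : forall H, val_rel b (b :: H) (reflect b (var_cls b H)) (mvar vz)).
    { intros H; apply IHb; [constructor|apply var_cls_rel]. }
    split.
    + intros H F W HW HF H1 e1 d U HU Hd H2 e2 c k K HK H3 e3 N.
      apply IHa' in Hd; [|exact HU].
      cbn [reflect]; rewrite to_of_fam.
      (* Running the continuation on the fresh variable instantiates [K] at its own bound variable,
         which gives back [K]. *)
      assert (HB : forall B,
        to_fam (k (reflect b (var_cls b H3))) (b :: H3) c B <->
        lc_eq (mrename K (up_ren (shift e3))) B).
      { intros B.
        pose proof (HK _ (ext_cons b e3) _ _ (val_var vz) (Hvar' H3)
          _ ext_refl B) as E.
        rewrite mshift_refl in E.
        change (ext_cons b e3) with (ext_trans e3 (ext_cons b ext_refl)) in E.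
        rewrite <- inst_mshift, inst_var in E; exact E. }
      assert (HF' : forall P, F H3 P <-> lc_eq (mshift (mshift (mshift W e1) e2) e3) P).
      { intros P; rewrite !mshift_mshift; apply HF. }
      assert (Hd' : forall Q, reify a d H3 Q <-> lc_eq (mshift (mshift U e2) e3) Q).
      { intros Q; rewrite mshift_mshift; apply Hd. }
      split.
      * intros (P & Q & B & HP & HQ & EB & EN).
        apply HF' in HP; apply Hd' in HQ; apply HB in EB.
        eapply lc_trans; [|exact EN].
        exact (mlet_congr _ _ _ _ (lc_app _ _ _ _ HP HQ) EB).
      * intros EN; do 3 eexists.
        split; [apply HF', lc_refl|split; [apply Hd', lc_refl|]].
        split; [apply HB, lc_refl|exact EN].
    + intros H d W HW Hd H' e N; cbn [reify].
      assert (HB : forall B,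
        to_fam (d (reflect a (var_cls a H'))
          (fun v => of_fam (retype (reify b v)))) (a :: H') b B <->
        lc_eq (mapp (mweaken a (mshift W e)) (mvar vz)) B).
      { intros B.
        pose proof (Hd _ (ext_cons a e) _ _ (val_var vz) (Hvar H')) as Hc.
        apply comp_rel_run in Hc.
        (* The term matching the final continuation is the let-bound variable itself; [lc_let_unit]
           then erases the let. *)
        specialize (Hc b (fun v => of_fam (retype (reify b v))) (mvar vz)).
        assert (E : lc_eq (mapp (mshift W (ext_cons a e)) (mvar vz))
          (mapp (mweaken a (mshift W e)) (mvar vz))).
        { unfold mweaken, mshift; rewrite mrename_mrename; apply lc_refl. }
        eapply cls_rel_eq in Hc.
        - pose proof (Hc _ ext_refl B) as HB; rewrite mshift_refl in HB; exact HB.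
        - eapply lc_trans; [apply lc_let_unit|exact E].
        - intros H1 e1 v U HU Hv H2 e2 M; rewrite to_of_fam, retype_self.
          rewrite inst_vz; apply IHb'; assumption. }
      pose proof (lc_lam_eta _ (is_value_mrename W (shift e) HW)) as E.
      split.
      * intros (B & HdB & EN); apply HB in HdB.
        eapply lc_trans; [apply lc_sym, E|].
        eapply lc_trans; [apply lc_lam, HdB|exact EN].
      * intros EN; eexists; split; [apply HB, lc_refl|].
        eapply lc_trans; [exact E|exact EN].
Qed.

(** * Let-conversions in the computational lambda-calculus *)

Lemma mrename_as_msubst {H H' a} (M : tm H a) (r : ren H H') :
  mrename M r = msubst M (fun _ v => mvar (r _ v)).
Proof.
  rewrite <- (msubst_id (mrename M r)), msubst_mrename; reflexivity.
Qed.

Lemma mlet_value {H a b} (W : tm H a) (K : tm (a :: H) b) :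
  is_value W -> lc_eq (mlet W K) (inst K ext_refl W).
Proof. intros HW; exact (lc_lam_beta K W HW). Qed.

Lemma mlet_mlet_mlet {H a b c d} (M : tm H a) (N : tm (a :: H) b)
    (P : tm (b :: a :: H) c) (K : tm (c :: H) d) :
  lc_eq (mlet (mlet M (mlet N P)) K)
    (mlet M (mlet N (mlet P (mrename K (up_ren (fun _ v => vs (vs v))))))).
Proof.
  eapply lc_trans; [apply lc_let_assoc|].
  apply mlet_congr; [apply lc_refl|].
  eapply lc_trans; [apply lc_let_assoc|].
  rewrite mrename_mrename, up_ren_comp; apply lc_refl.
Qed.

Lemma msubst1_up_ren {H H' a b} (K : tm (a :: H) b) (r : ren H H') (W : tm H' a) :
  msubst1 (mrename K (up_ren r)) W =
  msubst K (msub_cons W (fun _ v => mvar (r _ v))).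
Proof. unfold msubst1; rewrite msubst_mrename, msub_cons_up_ren; reflexivity. Qed.

Lemma mlet_mpair {H a b c} (M : tm H a) (N : tm H b) (K : tm (sprod a b :: H) c) :
  lc_eq (mlet (mpair M N) K)
    (mlet M (mlet (mweaken a N)
      (msubst K (msub_cons (mpair (mvar (vs vz)) (mvar vz))
        (fun _ v => mvar (vs (vs v))))))).
Proof.
  eapply lc_trans; [apply mlet_congr; [apply lc_let_pair|apply lc_refl]|].
  eapply lc_trans; [apply mlet_mlet_mlet|].
  do 2 (apply mlet_congr; [apply lc_refl|]).
  eapply lc_trans; [apply lc_lam_beta; repeat constructor|].
  rewrite msubst1_up_ren; apply lc_refl.
Qed.

Lemma mlet_mapp {H a b c} (M : tm H (sarr a b)) (N : tm H a) (K : tm (b :: H) c) :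
  lc_eq (mlet (mapp M N) K)
    (mlet M (mlet (mweaken _ N) (mlet (mapp (mvar (vs vz)) (mvar vz))
      (mrename K (up_ren (fun _ v => vs (vs v))))))).
Proof.
  eapply lc_trans; [apply mlet_congr; [apply lc_let_app|apply lc_refl]|].
  apply mlet_mlet_mlet.
Qed.

Lemma mlet_mlet_value {H a b c} (M : tm H a) (W : tm (a :: H) b) (K : tm (b :: H) c) :
  is_value W ->
  lc_eq (mlet (mlet M W) K)
    (mlet M (msubst K (msub_cons W (fun _ v => mvar (vs v))))).
Proof.
  intros HW; eapply lc_trans; [apply lc_let_assoc|].
  apply mlet_congr; [apply lc_refl|].
  eapply lc_trans; [apply lc_lam_beta, HW|].
  rewrite msubst1_up_ren; apply lc_refl.
Qed.

(** * The translation is related to the terms it comes from *)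

Definition env_rel {H0 H} (g : env fam (lvctx incl R H0)) (s : msub H0 H) : Prop :=
  forall a v, is_value (s a v) /\ val_rel a H (g _ (lvvar incl R v)) (s a v).

Definition msub_shift {H0 H H'} (s : msub H0 H) (e : ext H H') : msub H0 H' :=
  fun a v => mshift (s a v) e.

Lemma env_rel_shift {H0 H H'} (g : env fam (lvctx incl R H0)) (s : msub H0 H)
    (e : ext H H') :
  env_rel g s -> env_rel g (msub_shift s e).
Proof.
  intros Hg a v; destruct (Hg a v).
  split; [apply is_value_mrename|apply val_rel_shift]; assumption.
Qed.

Lemma env_rel_cons {H0 H a} (g : env fam (lvctx incl R H0)) (s : msub H0 H) d W :
  is_value W -> val_rel a H d W -> env_rel g s ->
  env_rel (H0 := a :: H0) (env_cons fam d g) (msub_cons W s).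
Proof.
  intros HW Hd Hg b v; dependent destruction v; [split; assumption|apply Hg].
Qed.

Lemma mshift_msubst {H0 H H' a} (M : tm H0 a) (s : msub H0 H) (e : ext H H') :
  mshift (msubst M s) e = msubst M (msub_shift s e).
Proof. apply mrename_msubst. Qed.

Lemma comp_rel_of_run {H0 a} (M : tm H0 a) x H (s : msub H0 H) :
  (forall H' (e : ext H H'),
    run_rel (val_rel a) x (msubst M (msub_shift s e))) ->
  comp_rel (val_rel a) x (msubst M s).
Proof. intros HM H' e; rewrite mshift_msubst; apply HM. Qed.

Lemma den_lvtm_mpair {H a b} (M : tm H a) (N : tm H b) g k :
  den fam (lvtm incl R (mpair M N)) g k =
  den fam (lvtm incl R M) g
    (fun v => den fam (lvtm incl R N) g (fun w => k (v, w))).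
Proof.
  cbn [lvtm den]; f_equal; extensionality v; rewrite den_weaken; f_equal.
  extensionality w; rewrite !to_v_of_v; reflexivity.
Qed.

Lemma den_lvtm_mapp {H a b} (M : tm H (sarr a b)) (N : tm H a) g k :
  den fam (lvtm incl R (mapp M N)) g k =
  den fam (lvtm incl R M) g
    (fun f => den fam (lvtm incl R N) g (fun w => f w k)).
Proof.
  cbn [lvtm den]; f_equal; extensionality f; rewrite den_weaken; f_equal.
  extensionality w; rewrite !to_v_of_v; reflexivity.
Qed.

Lemma inst_mlet_mweaken {H H' a b c} (N : tm H b) (K : tm (b :: a :: H) c)
    (e : ext H H') (W : tm H' a) :
  inst (mlet (mweaken a N) K) e W =
  mlet (mshift N e)
    (msubst K (up_msub (msub_cons W (fun _ v => mvar (shift e _ v))))).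
Proof.
  unfold inst, mlet, mshift; cbn [msubst].
  rewrite msubst_mweaken, mrename_as_msubst; reflexivity.
Qed.

Lemma inst_up_inst {H H' H'' a b c d} (K : tm (c :: H) d) (P : tm (b :: a :: H) c)
    (e : ext H H') (e' : ext H' H'') (W : tm H' a) (W' : tm H'' b) :
  inst (msubst (msubst K (msub_cons P (fun _ v => mvar (vs (vs v)))))
    (up_msub (msub_cons W (fun _ v => mvar (shift e _ v))))) e' W' =
  inst K (ext_trans e e')
    (inst (msubst P (up_msub (msub_cons W (fun _ v => mvar (shift e _ v))))) e' W').
Proof.
  unfold inst; rewrite !msubst_msubst; f_equal.
  extensionality x; extensionality v; dependent destruction v; cbn.
  - reflexivity.
  - rewrite shift_trans; reflexivity.
Qed.

Lemma inst_msubst {H H' a b c} (K : tm (b :: H) c) (P : tm (a :: H) b)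
    (e : ext H H') (W : tm H' a) :
  inst (msubst K (msub_cons P (fun _ v => mvar (vs v)))) e W =
  inst K e (inst P e W).
Proof.
  unfold inst; rewrite !msubst_msubst; f_equal.
  extensionality x; extensionality v; dependent destruction v; reflexivity.
Qed.

(** Let laws rearrange the term until the subterm that the CPS clause runs first is outermost; the
    rest of the let then matches the continuation in that clause. Values are substituted into [K] by
    beta. *)
Lemma lvtm_rel {H0 a} (M : tm H0 a) : forall H g (s : msub H0 H),
  env_rel g s -> run_rel (val_rel a) (den fam (lvtm incl R M) g) (msubst M s).
Proof.
  induction M as [H0 a v|H0|H0 a b M IHM N IHN|H0 a b M IHM|H0 a b M IHM
    |H0 a b M IHM|H0 a b M IHM N IHN]; intros H g s Hg c k K HK.
  - cbn [lvtm den]; rewrite to_v_of_v; destruct (Hg a v) as [Hv Hr].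
    eapply cls_rel_eq; [apply lc_sym, mlet_value, Hv|].
    apply (HK H ext_refl); assumption.
  - eapply cls_rel_eq; [apply lc_sym, mlet_value; constructor|].
    apply (HK H ext_refl); constructor.
  - rewrite den_lvtm_mpair; cbn [msubst].
    eapply cls_rel_eq; [apply lc_sym, mlet_mpair|].
    apply (IHM H g s Hg); intros H1 e1 v W HW Hv.
    rewrite inst_mlet_mweaken, mshift_msubst.
    apply (IHN H1 g _ (env_rel_shift g s e1 Hg)); intros H2 e2 w W' HW' Hw.
    rewrite inst_up_inst.
    assert (E : inst (msubst (mpair (mvar (vs vz)) (mvar vz))
      (up_msub (msub_cons W (fun _ v => mvar (shift e1 _ v))))) e2 W' =
      mpair (mshift W e2) W').
    { unfold inst, mshift; cbn [msubst up_msub msub_cons].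
      rewrite msubst_mweaken, mrename_as_msubst; reflexivity. }
    rewrite E.
    assert (HW2 : is_value (mshift W e2)) by (apply is_value_mrename, HW).
    apply HK; [constructor; assumption|split].
    + eapply val_rel_eq; [apply lc_sym, lc_fst_beta; assumption|].
      apply val_rel_shift, Hv.
    + eapply val_rel_eq; [apply lc_sym, lc_snd_beta; assumption|exact Hw].
  - eapply cls_rel_eq.
    { eapply lc_sym, lc_trans.
      - apply mlet_congr; [apply lc_let_fst|apply lc_refl].
      - apply mlet_mlet_value; repeat constructor. }
    replace (den fam (lvtm incl R (mfst M)) g k) with
      (den fam (lvtm incl R M) g (fun v => k (fst v))).
    2: { cbn [lvtm den]; f_equal; extensionality v.
         rewrite !to_v_of_v; reflexivity. }
    apply (IHM H g s Hg); intros H1 e1 v W HW [Ha Hb].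
    rewrite inst_msubst; apply HK; [constructor; exact HW|exact Ha].
  - eapply cls_rel_eq.
    { eapply lc_sym, lc_trans.
      - apply mlet_congr; [apply lc_let_snd|apply lc_refl].
      - apply mlet_mlet_value; repeat constructor. }
    replace (den fam (lvtm incl R (msnd M)) g k) with
      (den fam (lvtm incl R M) g (fun v => k (snd v))).
    2: { cbn [lvtm den]; f_equal; extensionality v.
         rewrite !to_v_of_v; reflexivity. }
    apply (IHM H g s Hg); intros H1 e1 v W HW [Ha Hb].
    rewrite inst_msubst; apply HK; [constructor; exact HW|exact Hb].
  - eapply cls_rel_eq; [apply lc_sym, mlet_value; constructor|].
    apply (HK H ext_refl); [constructor|].
    intros H1 e1 d W HW Hd.
    apply (comp_rel_eq (val_rel b) _ (msubst M (msub_cons W (msub_shift s e1)))).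
    + eapply lc_trans; [|apply lc_sym, lc_lam_beta, HW].
      rewrite msubst1_up_ren, msubst_msubst.
      replace (fun x (v : var (a :: H0) x) => msubst (up_msub s x v)
          (msub_cons W (fun y w => mvar (shift e1 y w))))
        with (msub_cons W (msub_shift s e1)); [apply lc_refl|].
      unfold up_msub; rewrite msub_cons_msubst; cbn [msubst msub_cons]; f_equal.
      extensionality x; extensionality v; rewrite msubst_mweaken.
      apply mrename_as_msubst.
    + apply comp_rel_of_run; intros H2 e2.
      apply IHM; unfold msub_shift.
      apply (env_rel_shift (H0 := a :: H0)), env_rel_cons; try assumption.
      apply env_rel_shift, Hg.
  - rewrite den_lvtm_mapp; cbn [msubst].
    eapply cls_rel_eq; [apply lc_sym, mlet_mapp|].
    apply (IHM H g s Hg); intros H1 e1 v W HW Hv.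
    rewrite inst_mlet_mweaken, mshift_msubst.
    apply (IHN H1 g _ (env_rel_shift g s e1 Hg)); intros H2 e2 w W' HW' Hw.
    (* As in [(f x){k}], the related functions receive the original continuation unchanged, up to
       weakening of [K]. *)
    pose proof (comp_rel_run _ _ _ (Hv H2 e2 w W' HW' Hw) c k
      (mrename K (up_ren (shift (ext_trans e1 e2))))) as E.
    assert (EK : inst (msubst (mlet (mapp (mvar (vs vz)) (mvar vz))
        (mrename K (up_ren (fun _ v => vs (vs v)))))
        (up_msub (msub_cons W (fun _ v => mvar (shift e1 _ v))))) e2 W' =
      mlet (mapp (mshift W e2) W')
        (mrename K (up_ren (shift (ext_trans e1 e2))))).
    { unfold inst, mlet, mshift; cbn [msubst]; f_equal.
      - f_equal; rewrite !msubst_msubst, msubst_mrename, mrename_as_msubst.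
        f_equal; extensionality x; extensionality u; dependent destruction u.
        + reflexivity.
        + cbn; rewrite shift_trans; reflexivity.
      - cbn [msubst up_msub msub_cons].
        rewrite msubst_mweaken, mrename_as_msubst; reflexivity. }
    rewrite EK; apply E.
    intros H3 e3 u U HU Hu; rewrite inst_mshift; apply HK; assumption.
Qed.

Fixpoint id_env H : env fam (lvctx incl R H) :=
  match H return env fam (lvctx incl R H) with
  | [] => fun A v => match v in var G _ return
        match G with [] => vden fam A | _ :: _ => unit end with
      | vz => tt
      | vs _ => tt
      end
  | a :: H => env_cons fam (reflect a (var_cls a H)) (id_env H)
  end.

(** Each variable is reflected in the context where it was introduced and reaches [H] by
    [val_rel_shift]. *)
Lemma id_env_rel H : env_rel (id_env H) (fun a v => mvar v).
Proof.
  induction H as [|a H IH]; intros b v; [inversion v|].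
  split; [constructor|]; dependent destruction v.
  - apply reflect_reify_rel; [constructor|apply var_cls_rel].
  - exact (val_rel_shift b H _ (ext_cons a ext_refl) _ _ (proj2 (IH b v))).
Qed.

Lemma lvtm_nbe {H a} (M : tm H a) :
  fam_rel (to_fam (den fam (lvtm incl R M) (id_env H)
    (fun v => of_fam (retype (reify a v))))) M.
Proof.
  eapply cls_rel_eq; [apply lc_let_unit|].
  pose proof (lvtm_rel M H _ _ (id_env_rel H)) as HM.
  rewrite msubst_id in HM; apply HM.
  intros H1 e1 v W HW Hv H2 e2 N; rewrite to_of_fam, retype_self, inst_vz.
  apply reflect_reify_rel; assumption.
Qed.

(** By soundness both translations read back to one family, which is the class of [M] and also that
    of [N]. *)
Theorem lvtm_faithful {H a} (M N : tm H a) :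
  eec_eq (lvtm incl R M) (lvtm incl R N) -> lc_eq M N.
Proof.
  intros E; apply (eec_eq_sound fam) with (g := id_env H) in E.
  pose proof (lvtm_nbe M) as HM; pose proof (lvtm_nbe N) as HN.
  rewrite E in HM.
  specialize (HM H ext_refl N); specialize (HN H ext_refl N).
  rewrite mshift_refl in HM, HN.
  apply HM, HN, lc_refl.
Qed.

End Faithfulness.

Theorem theorem4p3 (L V C : Type) (incl : L -> V)
    (incl_inj : forall a b : L, incl a = incl b -> a = b)
    (R : cty V C)
    (hR : (exists c : C, R = cconst c) \/ R = cI) :
  (forall (Theta : list (sty L)) (tau : sty L) (M N : tm Theta tau),
      eec_eq (lvtm incl R M) (lvtm incl R N) -> lc_eq M N)
  /\
  (forall (Theta : list (sty L)) (tau : sty L)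
          (t : term (lvctx incl R Theta) None
                    (vlolli (cpow (lvty incl R tau) R) R)),
      exists M : tm Theta tau, eec_eq (lvtm incl R M) t).
Proof.
  split.
  - intros H a M N.
    destruct hR as [[c ->]| ->].
    + exact (lvtm_faithful incl (cconst c) (fun f => f) (fun f => f)
        (fun f => eq_refl) M N).
    + exact (lvtm_faithful incl cI (fun f => f) (fun f => f)
        (fun f => eq_refl) M N).
  - intros H a; apply (lvtm_full incl R incl_inj).
    intros H' s; destruct hR as [[c ->]| ->]; reflexivity.
Qed.
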